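(* Let $k$ be a field and $s\ge1$. For all integers $n\ge1$: (i) the algebraic groups $(\mathfrak{G}^s_+)_n$ over $k$ are unipotent, and $\mathfrak{G}^s_+=\varprojlim_n(\mathfrak{G}^s_+)_n$ is pro-unipotent; (ii) the algebraic groups $(\mathfrak{G}^s)_n$ over $k$ and their inverse limit $\mathfrak{G}^s$ are trigonalisable.
   Context: For a commutative unital $k$-algebra $R$, $R_+\langle\langle z_1,\dots,z_s\rangle\rangle$ is the set of formal power series in $s$ non-commuting variables without constant term, $f=\sum_{|w|\ge1}X_w(f)z_w$, indexed by non-empty words $w=(i_1\dots i_n)$ in $\{1,\dots,s\}$ of length $|w|=n$, $z_w=z_{i_1}\cdots z_{i_n}$. $\operatorname{NC}(n)$ is the set of non-crossing partitions of $\{1,\dots,n\}$. The Kreweras complement $K(\pi)$ of $\pi\in\operatorname{NC}(n)$ is the maximal (for the order in which $\sigma\le\pi$ iff every block of $\sigma$ lies in a block of $\pi$) non-crossing partition of $\{\bar1,\dots,\bar n\}$ (identified with $\{1,\dots,n\}$) such that $\pi\cup K(\pi)$ is a non-crossing partition of $1<\bar1<2<\dots<n<\bar n$. With $w|V=(i_{v_1}\dots i_{v_m})$ for $V=\{v_1<\dots<v_m\}$ and $X_{w,\pi}(f)=\prod_{V\in\pi}X_{w|V}(f)$, the boxed convolution is $X_w(f\boxtimes g)=\sum_{\pi\in\operatorname{NC}(|w|)}X_{w,\pi}(f)X_{w,K(\pi)}(g)$. $\mathfrak{G}^s(R)$ is the set of $f$ with $X_i(f)\in R^\times$ for $i=1,\dots,s$,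 $\mathfrak{G}^s_+(R)$ the subset with $X_i(f)=1$ for $i=1,\dots,s$; $(\mathfrak{G}^s)_n(R)$ and $(\mathfrak{G}^s_+)_n(R)$ are their truncations to words of length $\le n$. All are groups under ($n$-truncated) $\boxtimes$ and, acting coefficientwise on morphisms, are affine group schemes over $k$. An affine group scheme $G$ over $k$ is unipotent if every non-zero linear representation of $G$ has a non-zero fixed vector, i.e. in the associated $k[G]$-comodule $(V,\rho)$ there is $v\ne0$ with $\rho(v)=v\otimes1$. It is trigonalisable if every non-zero linear representation has a one-dimensional invariant subspace, i.e. there is $v\neq0$ with $\rho(v)=v\otimes a$ for some $a\in k[G]$. Pro-unipotent means an inverse limit of unipotent algebraic groups. *)

(* Defs.v *)
From HB Require Import structures.
From mathcomp Require Import all_boot all_order all_algebra.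
From mathcomp Require Import boolp.

Set Implicit Arguments.
Unset Strict Implicit.
Unset Printing Implicit Defensive.

Import GRing.Theory.
Local Open Scope ring_scope.
Local Open Scope quotient_scope.

(* The tensor product V (x)_k R as an R-module: finite formal sums of pure    *)
(* tensors (the sequence [:: (v1, r1); ..; (vn, rn)] stands for               *)
(* v1 (x) r1 + .. + vn (x) rn) modulo the bilinear relations.                 *)

Section TensorRel.
Variables (k : fieldType) (V : lmodType k) (R : comAlgType k).

Inductive tens_eq : seq (V * R) -> seq (V * R) -> Prop :=
| TensRefl s : tens_eq s s
| TensSym s t : tens_eq s t -> tens_eq t s
| TensTrans s t u : tens_eq s t -> tens_eq t u -> tens_eq s u
| TensCat s s' t t' : tens_eq s s' -> tens_eq t t' -> tens_eq (s ++ t) (s' ++ t')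
| TensComm s t : tens_eq (s ++ t) (t ++ s)
| TensZero r : tens_eq [:: (0, r)] [::]
| TensAddl v v' r : tens_eq [:: (v + v', r)] [:: (v, r); (v', r)]
| TensAddr v r r' : tens_eq [:: (v, r + r')] [:: (v, r); (v, r')]
| TensScale (a : k) v r : tens_eq [:: (a *: v, r)] [:: (v, a *: r)].

Definition tens_eqb (s t : seq (V * R)) : bool := `[< tens_eq s t >].

Lemma tens_eqb_refl : reflexive tens_eqb.
Proof. by move=> s; apply/asboolP; apply: TensRefl. Qed.

Lemma tens_eqb_sym : symmetric tens_eqb.
Proof. by move=> s t; apply/asboolP/asboolP; apply: TensSym. Qed.

Lemma tens_eqb_trans : transitive tens_eqb.
Proof.
by move=> t s u /asboolP st /asboolP tu; apply/asboolP; apply: TensTrans st tu.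
Qed.

Canonical tens_equiv := EquivRel tens_eqb tens_eqb_refl tens_eqb_sym tens_eqb_trans.

Definition tensor : Type := {eq_quot tens_equiv}.
HB.instance Definition _ := EqQuotient.on tensor.
HB.instance Definition _ := Choice.on tensor.

Definition tclass (s : seq (V * R)) : tensor := \pi_tensor s.

Lemma tclassP s t : tclass s = tclass t <-> tens_eq s t.
Proof.
split=> [/eqP|st]; last by apply/eqP; rewrite eqmodE; apply/asboolP.
by rewrite eqmodE => /asboolP.
Qed.

Definition tens (v : V) (r : R) : tensor := tclass [:: (v, r)].

Definition tens_add (x y : tensor) : tensor := tclass (repr x ++ repr y).

Definition tens_opp (x : tensor) : tensor :=
  tclass [seq (- p.1, p.2) | p <- repr x].

Definition tens_scale (a : R) (x : tensor) : tensor :=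
  tclass [seq (p.1, a * p.2) | p <- repr x].

Lemma tclass_repr x : tclass (repr x) = x.
Proof. exact: reprK. Qed.

Lemma tens_ind (P : tensor -> Prop) : (forall s, P (tclass s)) -> forall x, P x.
Proof. by move=> PP x; rewrite -(tclass_repr x). Qed.

Lemma repr_tclass s : tens_eq (repr (tclass s)) s.
Proof. by apply/tclassP; rewrite tclass_repr. Qed.

Lemma tens_addE s t : tens_add (tclass s) (tclass t) = tclass (s ++ t).
Proof. by apply/tclassP; apply: TensCat; apply: repr_tclass. Qed.

Lemma tens_eq_opp s t : tens_eq s t ->
  tens_eq [seq (- p.1, p.2) | p <- s] [seq (- p.1, p.2) | p <- t].
Proof.
elim=> {s t} [s|s t _|s t u _ + _|s s' t t' _ + _|s t|r|v v' r|v r r'|a v r] /=.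
- exact: TensRefl.
- exact: TensSym.
- exact: TensTrans.
- by rewrite !map_cat; apply: TensCat.
- by rewrite !map_cat; apply: TensComm.
- by rewrite oppr0; apply: TensZero.
- by rewrite opprD; apply: TensAddl.
- exact: TensAddr.
- by rewrite -scalerN; apply: TensScale.
Qed.

Lemma tens_oppE s : tens_opp (tclass s) = tclass [seq (- p.1, p.2) | p <- s].
Proof. by apply/tclassP; apply: tens_eq_opp; apply: repr_tclass. Qed.

Lemma tens_eq_scale b s t : tens_eq s t ->
  tens_eq [seq (p.1, b * p.2) | p <- s] [seq (p.1, b * p.2) | p <- t].
Proof.
elim=> {s t} [s|s t _|s t u _ + _|s s' t t' _ + _|s t|r|v v' r|v r r'|a v r] /=.
- exact: TensRefl.
- exact: TensSym.
- exact: TensTrans.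
- by rewrite !map_cat; apply: TensCat.
- by rewrite !map_cat; apply: TensComm.
- exact: TensZero.
- exact: TensAddl.
- by rewrite mulrDr; apply: TensAddr.
- by rewrite -scalerAr; apply: TensScale.
Qed.

Lemma tens_scaleE a s :
  tens_scale a (tclass s) = tclass [seq (p.1, a * p.2) | p <- s].
Proof. by apply/tclassP; apply: tens_eq_scale; apply: repr_tclass. Qed.

Lemma tens_addA : associative tens_add.
Proof.
by elim/tens_ind=> x; elim/tens_ind=> y; elim/tens_ind=> z; rewrite !tens_addE catA.
Qed.

Lemma tens_addC : commutative tens_add.
Proof.
elim/tens_ind=> x; elim/tens_ind=> y; rewrite !tens_addE.
by apply/tclassP; apply: TensComm.
Qed.

Lemma tens_add0 : left_id (tclass [::]) tens_add.
Proof. by elim/tens_ind=> x; rewrite tens_addE. Qed.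

Lemma tens_addN : left_inverse (tclass [::]) tens_opp tens_add.
Proof.
elim/tens_ind=> x; rewrite tens_oppE tens_addE; apply/tclassP.
elim: x => [|[v r] x IHx] /=; first exact: TensRefl.
set y := [seq _ | _ <- x] in IHx *.
rewrite -[(- v, r) :: _]/([:: (- v, r)] ++ (y ++ [:: (v, r)] ++ x)).
apply: TensTrans (_ : tens_eq _ (([:: (- v, r)] ++ [:: (v, r)]) ++ (y ++ x))) _.
  rewrite -catA; apply: TensCat; first exact: TensRefl.
  rewrite !catA; apply: TensCat; [exact: TensComm|exact: TensRefl].
rewrite -[[::]]/([::] ++ [::] : seq (V * R)); apply: TensCat => //=.
apply: TensTrans (TensSym (TensAddl _ _ _)) _.
by rewrite addNr; apply: TensZero.
Qed.

HB.instance Definition _ :=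
  GRing.isZmodule.Build tensor tens_addA tens_addC tens_add0 tens_addN.

Lemma tens_scaleA a b x : tens_scale a (tens_scale b x) = tens_scale (a * b) x.
Proof.
elim/tens_ind: x => x; rewrite !tens_scaleE -map_comp; congr tclass.
by apply: eq_map => p /=; rewrite mulrA.
Qed.

Lemma tens_scale1 : left_id 1 tens_scale.
Proof.
elim/tens_ind=> x; rewrite tens_scaleE; congr tclass.
by rewrite -[RHS]map_id; apply: eq_map => -[v r] /=; rewrite mul1r.
Qed.

Lemma tens_scaleDr : right_distributive tens_scale +%R.
Proof.
move=> a; elim/tens_ind=> x; elim/tens_ind=> y.
by rewrite /GRing.add/= !(tens_addE, tens_scaleE) map_cat.
Qed.

Lemma tens_scaleDl x : {morph tens_scale^~ x : a b / a + b}.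
Proof.
move=> a b; elim/tens_ind: x => x.
rewrite [in RHS]/GRing.add/= !(tens_addE, tens_scaleE); apply/tclassP.
elim: x => [|[v r] x IHx] /=; first exact: TensRefl.
set y := map _ x in IHx *; set z := map _ x in IHx *.
set y' := map _ x in IHx *.
apply: TensTrans (_ : tens_eq _ (([:: (v, a * r)] ++ [:: (v, b * r)]) ++ (z ++ y'))) _.
  rewrite -cat1s; apply: TensCat => //=.
  by rewrite mulrDl; apply: TensAddr.
rewrite -catA -[X in tens_eq _ X]cat1s; apply: TensCat; first exact: TensRefl.
rewrite -[_ :: y']cat1s !catA; apply: TensCat; [exact: TensComm|exact: TensRefl].
Qed.

HB.instance Definition _ := GRing.Zmodule_isLmodule.Build R tensor
  tens_scaleA tens_scale1 tens_scaleDr tens_scaleDl.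

End TensorRel.

(* id_V (x) phi                                                               *)
Definition tens_map (k : fieldType) (V : lmodType k) (R R' : comAlgType k)
    (phi : {lrmorphism R -> R'}) (x : tensor V R) : tensor V R' :=
  tclass [seq (p.1, phi p.2) | p <- repr x].

Lemma tens_eq_map (k : fieldType) (V : lmodType k) (R R' : comAlgType k)
    (phi : {lrmorphism R -> R'}) (s t : seq (V * R)) : tens_eq s t ->
  tens_eq [seq (p.1, phi p.2) | p <- s] [seq (p.1, phi p.2) | p <- t].
Proof.
elim=> {s t} [s|s t _|s t u _ + _|s s' t t' _ + _|s t|r|v v' r|v r r'|a v r] /=.
- exact: TensRefl.
- exact: TensSym.
- exact: TensTrans.
- by rewrite !map_cat; apply: TensCat.
- by rewrite !map_cat; apply: TensComm.
- exact: TensZero.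
- exact: TensAddl.
- by rewrite rmorphD; apply: TensAddr.
- by rewrite linearZ; apply: TensScale.
Qed.

Lemma tens_mapE (k : fieldType) (V : lmodType k) (R R' : comAlgType k)
    (phi : {lrmorphism R -> R'}) (s : seq (V * R)) :
  tens_map phi (tclass s) = tclass [seq (p.1, phi p.2) | p <- s].
Proof. by apply/tclassP; apply: tens_eq_map; apply: repr_tclass. Qed.

(* Affine group schemes are taken as functors of points. A comAlgType is a    *)
(* non-zero ring; leaving out the zero algebra (where G is a single point)    *)
(* loses no information. group_data carries the operations only, the axioms   *)
(* are in group_functor and affine_group_scheme below.                        *)

Record group_data (k : fieldType) := GroupData {
  points :> comAlgType k -> Type;
  gmul : forall R, points R -> points R -> points R;
  gone : forall R, points R;
  gmap : forall R R' : comAlgType k,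
    {lrmorphism R -> R'} -> points R -> points R'
}.
Arguments gmul {k} G {R} : rename.
Arguments gone {k} G R : rename.
Arguments gmap {k} G {R R'} : rename.

Section GroupSchemes.
Variable k : fieldType.
Implicit Types (G H : group_data k) (A R : comAlgType k).

Definition group_axioms G R : Prop :=
  [/\ associative (@gmul k G R), left_id (gone G R) (gmul G),
      right_id (gone G R) (gmul G)
    & forall x : G R, exists y : G R,
        gmul G y x = gone G R /\ gmul G x y = gone G R].

Definition group_functor G : Prop :=
  [/\ forall R, group_axioms G R,
      forall R (x : G R), gmap G (idfun : {lrmorphism R -> R}) x = x,
      forall R1 R2 R3 (phi : {lrmorphism R1 -> R2}) (psi : {lrmorphism R2 -> R3})
        (x : G R1),
        gmap G (psi \o phi : {lrmorphism R1 -> R3}) x = gmap G psi (gmap G phi x)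
    & forall R R' (phi : {lrmorphism R -> R'}) (x y : G R),
        gmap G phi (gmul G x y) = gmul G (gmap G phi x) (gmap G phi y)].

(* A is a coordinate ring k[G] of G, with universal point u in G(A).          *)
Definition coordinate_ring G A (u : G A) : Prop :=
  forall R (x : G R),
    (exists phi : {lrmorphism A -> R}, gmap G phi u = x) /\
    (forall phi psi : {lrmorphism A -> R},
       gmap G phi u = x -> gmap G psi u = x -> phi =1 psi).

Definition affine_group_scheme G : Prop :=
  group_functor G /\ exists A (u : G A), coordinate_ring u.

Definition finitely_generated A : Prop :=
  exists gens : seq A, forall S : {pred A},
    subalg_closed S -> {subset gens <= S} -> forall a, a \in S.

Definition algebraic_group G : Prop :=
  affine_group_scheme G /\
  exists A (u : G A), coordinate_ring u /\ finitely_generated A.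

Record representation G (V : lmodType k) := Representation {
  rep_act : forall R, G R -> tensor V R -> tensor V R;
  rep_act_linear : forall R (g : G R), linear (rep_act g);
  rep_act1 : forall R (x : tensor V R), rep_act (gone G R) x = x;
  rep_actM : forall R (g h : G R) (x : tensor V R),
    rep_act (gmul G g h) x = rep_act g (rep_act h x);
  rep_act_natural : forall R R' (phi : {lrmorphism R -> R'}) (g : G R)
    (x : tensor V R), tens_map phi (rep_act g x) = rep_act (gmap G phi g) (tens_map phi x)
}.

(* The associated comodule map rho : V -> V (x) k[G] sends v to the action of *)
(* the universal point u on v (x) 1.                                          *)
Definition coaction G A (u : G A) (V : lmodType k) (X : representation G V)
  (v : V) : tensor V A := rep_act X u (tens v 1).

Definition unipotent G : Prop :=
  affine_group_scheme G /\
  forall A (u : G A), coordinate_ring u ->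
  forall (V : lmodType k) (X : representation G V), (exists v : V, v != 0) ->
  exists2 v : V, v != 0 & coaction u X v = tens v 1.

Definition trigonalisable G : Prop :=
  affine_group_scheme G /\
  forall A (u : G A), coordinate_ring u ->
  forall (V : lmodType k) (X : representation G V), (exists v : V, v != 0) ->
  exists2 v : V, v != 0 & exists a : A, coaction u X v = tens v a.

Definition group_hom G H (t : forall R, G R -> H R) : Prop :=
  (forall R (x y : G R), t R (gmul G x y) = gmul H (t R x) (t R y)) /\
  (forall R R' (phi : {lrmorphism R -> R'}) (x : G R),
     t R' (gmap G phi x) = gmap H phi (t R x)).

Record inverse_system := InverseSystem {
  sys_index : Type;
  index_le : sys_index -> sys_index -> Prop;
  stage : sys_index -> group_data k;
  transition : forall i j, index_le i j -> forall R, stage j R -> stage i R;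
  index_inhabited : exists i : sys_index, True;
  index_refl : forall i, index_le i i;
  index_trans : forall i j l, index_le i j -> index_le j l -> index_le i l;
  index_directed : forall i j, exists l, index_le i l /\ index_le j l;
  transition_hom : forall i j (ij : index_le i j), group_hom (transition ij);
  transition_id : forall i (ii : index_le i i) R (x : stage i R),
    transition ii x = x;
  transition_comp : forall i j l (ij : index_le i j) (jl : index_le j l)
    (il : index_le i l) R (x : stage l R),
    transition ij (transition jl x) = transition il x
}.

Arguments stage : clear implicits.

Definition inverse_limit (S : inverse_system) G
    (p : forall i R, G R -> stage S i R) : Prop :=
  [/\ forall i, group_hom (p i),
      forall i j (ij : index_le i j) R (x : G R), transition ij (p j R x) = p i R x
    & forall R (y : forall i, stage S i R),
        (forall i j (ij : index_le i j), transition ij (y j) = y i) ->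
        exists! x : G R, forall i, p i R x = y i].

Definition pro_unipotent G : Prop :=
  affine_group_scheme G /\
  exists (S : inverse_system) (p : forall i R, G R -> stage S i R),
    (forall i : sys_index S, algebraic_group (stage S i) /\ unipotent (stage S i)) /\
    inverse_limit p.

End GroupSchemes.

Arguments stage {k} S i : rename.

Definition noncrossing m (pi : {set {set 'I_m}}) : bool :=
  [forall V in pi, forall W in pi, (V != W) ==>
    ~~ [exists a in V, exists b in W, exists c in V, exists d in W,
          [&& (a < b)%N, (b < c)%N & (c < d)%N]]].

Definition NC m : {set {set {set 'I_m}}} :=
  [set pi | partition pi [set: 'I_m] & noncrossing pi].

Definition refines m (sigma pi : {set {set 'I_m}}) : bool :=
  [forall V in sigma, exists W in pi, V \subset W].

Section Kreweras.
Variable n : nat.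

Lemma plain_subproof (i : 'I_n) : (i.*2 < n.*2)%N.
Proof. by rewrite ltn_double. Qed.

Lemma bar_subproof (i : 'I_n) : (i.*2.+1 < n.*2)%N.
Proof. by rewrite ltn_Sdouble. Qed.

(* The positions of i and of its barred copy in 1 < 1bar < 2 < 2bar < ...     *)
Definition plain (i : 'I_n) : 'I_n.*2 := Ordinal (plain_subproof i).
Definition bar (i : 'I_n) : 'I_n.*2 := Ordinal (bar_subproof i).

Definition interlace (pi sigma : {set {set 'I_n}}) : {set {set 'I_n.*2}} :=
  [set plain @: (V : {set 'I_n}) | V in pi] :|:
  [set bar @: (V : {set 'I_n}) | V in sigma].

Definition kreweras_compatible (pi : {set {set 'I_n}}) : {set {set {set 'I_n}}} :=
  [set sigma in NC n | interlace pi sigma \in NC n.*2].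

(* For pi in NC n the greatest element exists, so the default is never used.  *)
Definition kreweras (pi : {set {set 'I_n}}) : {set {set 'I_n}} :=
  odflt set0 [pick sigma in kreweras_compatible pi |
    [forall tau in kreweras_compatible pi, refines tau sigma]].

End Kreweras.

Lemma NC1P (pi : {set {set 'I_1}}) : pi \in NC 1 -> pi = [set setT].
Proof.
rewrite inE => /andP[/and3P[/eqP cov _ n0] _].
have T1 (V : {set 'I_1}) : V != set0 -> V = setT.
  case/set0Pn=> i iV; apply/setP=> j; rewrite inE.
  by rewrite (ord1 j) -(ord1 i).
have piT V : V \in pi -> V = setT.
  by move=> Vpi; apply: T1; apply: contraNneq n0 => <-.
apply/setP=> V; rewrite inE; apply/idP/eqP => [/piT//|->].
have: (ord0 : 'I_1) \in cover pi by rewrite cov inE.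
by case/bigcupP=> W Wpi _; rewrite -(piT _ Wpi).
Qed.

Lemma NC1_in : [set setT] \in NC 1.
Proof.
rewrite inE; apply/andP; split.
  apply/and3P; split; first by rewrite /cover big_set1.
    by apply/trivIsetP=> A B; rewrite !inE => /eqP-> /eqP->; rewrite eqxx.
  by rewrite inE; apply/eqP=> /setP/(_ ord0); rewrite !inE.
apply/forall_inP=> A; rewrite inE => /eqP->.
by apply/forall_inP=> B; rewrite inE => /eqP->; rewrite eqxx.
Qed.

Lemma interlace1 : interlace [set [set: 'I_1]] [set setT] \in NC 2.
Proof.
have T1 : [set: 'I_1] = [set ord0].
  by apply/setP=> i; rewrite !inE (ord1 i).
rewrite /interlace !imset_set1 T1 !imset_set1 inE; apply/andP; split.
  apply/and3P; split.
  - apply/eqP/setP=> i; rewrite [RHS]inE; apply/bigcupP.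
    exists [set i]; rewrite !inE // !(inj_eq set1_inj).
    by case: i => [[|[|[]]]].
  - apply/trivIsetP=> A B; rewrite !inE.
    by case/orP=> /eqP->; case/orP=> /eqP->;
       rewrite ?eqxx // disjoints1 !inE.
  - rewrite !inE negb_or; apply/andP; split; apply/negP=> /eqP/setP.
      by move/(_ (plain ord0)); rewrite !inE eqxx.
    by move/(_ (bar ord0)); rewrite !inE eqxx.
apply/forall_inP=> A _; apply/forall_inP=> B _; apply/implyP=> _.
apply/negP=> /exists_inP[a _] /exists_inP[b _] /exists_inP[c _] /exists_inP[d _].
case/and3P=> _ bc cd; have dle1 : (d <= 1)%N := ltn_ord d.
have cle0 : (c <= 0)%N := leq_trans cd dle1.
by have := leq_trans bc cle0.
Qed.

Lemma kreweras1 : kreweras [set [set: 'I_1]] = [set setT].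
Proof.
rewrite /kreweras; case: pickP => [sg|/(_ [set setT])].
  by rewrite !inE /= => /andP[/andP[+ _] _] => ?; apply: NC1P; rewrite inE.
rewrite inE NC1_in interlace1 /= => /negbT/negP[].
apply/forall_inP=> tau; rewrite inE => /andP[/NC1P-> _].
by apply/forall_inP=> V Vs; apply/exists_inP; exists V.
Qed.

(* D is the set of lengths of the words that are kept: all positive lengths   *)
(* for formal power series without constant term, 1, .., n for n-truncated    *)
(* ones.                                                                      *)

Definition positive_lengths : pred nat := [pred m | 0 < m]%N.
Definition lengths_upto (n : nat) : pred nat := [pred m | 0 < m <= n]%N.

Definition word (s : nat) (D : pred nat) := {w : seq 'I_s | D (size w)}.

Definition ncseries (s : nat) (D : pred nat) (R : Type) := word s D -> R.

(* w|V = (i_v1 .. i_vm) for V = {v1 < .. < vm}; note that enum V is sorted.   *)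
Definition subword (T : Type) (w : seq T) (V : {set 'I_(size w)}) : seq T :=
  [seq tnth (in_tuple w) i | i <- enum V].

Section Boxed.
Variables (s : nat) (D : pred nat) (k : fieldType) (R : comAlgType k).
Implicit Types f g : ncseries s D R.

(* X_w(f), extended by 0 to the words that are not kept.                      *)
Definition coef f (w : seq 'I_s) : R := oapp f 0 (insub w).

Definition coef_part f (w : seq 'I_s) (pi : {set {set 'I_(size w)}}) : R :=
  \prod_(V in pi) coef f (subword V).

Definition boxed f g : ncseries s D R := fun w =>
  \sum_(pi in NC (size (val w))) coef_part f pi * coef_part g (kreweras pi).

Definition boxed_unit : ncseries s D R := fun w => (size (val w) == 1%N)%:R.

Lemma coef_val f (w : word s D) : coef f (val w) = f w.
Proof. by rewrite /coef valK. Qed.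

Lemma coef_part1 f (i : 'I_s) (w := [:: i]) :
  coef_part f [set [set: 'I_(size w)]] = coef f w.
Proof.
rewrite /coef_part big_set1; congr coef.
rewrite /subword; have -> : enum [set: 'I_(size w)] = [:: ord0].
  by rewrite enum_setT -enumT enum_ordSl; case: (enum 'I_0) (size_enum_ord 0) => [|[]].
by [].
Qed.

Lemma boxed_letter f g (w : word s D) : size (val w) = 1%N ->
  boxed f g w = f w * g w.
Proof.
rewrite -(coef_val f w) -(coef_val g w) /boxed.
case: w => [[|i []] //= Dw] _.
rewrite (bigD1 [set setT]) ?NC1_in //= big1 ?addr0 => [|pi /andP[/NC1P->]].
  by rewrite kreweras1 !coef_part1.
by rewrite eqxx.
Qed.

End Boxed.

(* The condition on X_i(f): equal to 1 for G_+ (plus = true), a unit for G    *)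
(* (spelled out, as GRing.unit is not available on a comAlgType).             *)
Definition letter_cond (plus : bool) (k : fieldType) (R : comAlgType k) (x : R) :
  Prop := if plus then x = 1 else exists y, x * y = 1.

Section GroupSeries.
Variables (k : fieldType) (s : nat).

Section Points.
Variables (plus : bool) (D : pred nat).

Definition gseries (R : comAlgType k) : Type :=
  {f : ncseries s D R | forall w, size (val w) = 1%N -> letter_cond plus (f w)}.

Lemma gseries_mul_subproof (R : comAlgType k) (f g : gseries R) w :
  size (val w) = 1%N -> letter_cond plus (boxed (sval f) (sval g) w).
Proof.
case: f g => f fP [g gP] /= w1; rewrite boxed_letter //.
move: (fP w w1) (gP w w1); rewrite /letter_cond; case: plus => [->->|].
  by rewrite mulr1.
by move=> [x fx] [y gy]; exists (x * y); rewrite mulrACA fx gy mulr1.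
Qed.

Definition gseries_mul (R : comAlgType k) (f g : gseries R) : gseries R :=
  exist _ _ (gseries_mul_subproof f g).

Lemma gseries_one_subproof (R : comAlgType k) (w : word s D) :
  size (val w) = 1%N -> letter_cond plus (boxed_unit R w).
Proof.
move=> w1; rewrite /boxed_unit w1 eqxx /letter_cond; case: plus => //.
by exists 1; rewrite mulr1.
Qed.

Definition gseries_one (R : comAlgType k) : gseries R :=
  exist _ _ (@gseries_one_subproof R).

Lemma gseries_map_subproof (R R' : comAlgType k) (phi : {lrmorphism R -> R'})
    (f : gseries R) w :
  size (val w) = 1%N -> letter_cond plus (phi (sval f w)).
Proof.
case: f => f fP /= w1; move: (fP w w1); rewrite /letter_cond.
case: plus => [->|[y fy]]; first by rewrite rmorph1.
by exists (phi y); rewrite -rmorphM fy rmorph1.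
Qed.

Definition gseries_map (R R' : comAlgType k) (phi : {lrmorphism R -> R'})
    (f : gseries R) : gseries R' :=
  exist _ _ (gseries_map_subproof phi f).

Definition gseries_group : group_data k :=
  GroupData gseries_mul gseries_one gseries_map.

End Points.

Definition GG : group_data k := gseries_group false positive_lengths.
Definition GG_plus : group_data k := gseries_group true positive_lengths.
Definition GG_trunc (n : nat) : group_data k := gseries_group false (lengths_upto n).
Definition GG_plus_trunc (n : nat) : group_data k :=
  gseries_group true (lengths_upto n).

Section Truncation.
Variables (plus : bool) (D E : pred nat) (DE : {subset D <= E}).

Lemma truncate_subproof (R : comAlgType k) (f : gseries plus E R) (w : word s D) :
  size (val w) = 1%N -> letter_cond plus (coef (sval f) (val w)).
Proof.
case: f => f fP /= w1; have Ew : E (size (val w)) by apply: DE; apply: (valP w).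
by rewrite -[val w]/(val (Sub (val w) Ew : word s E)) coef_val; apply: fP.
Qed.

Definition truncate (R : comAlgType k) (f : gseries plus E R) : gseries plus D R :=
  exist _ _ (truncate_subproof f).

End Truncation.

Section Tower.
Variable plus : bool.

Lemma lengths_upto_leq m n : (m <= n)%N ->
  {subset lengths_upto m <= lengths_upto n}.
Proof. by move=> mn l; rewrite !inE => /andP[-> /leq_trans->]. Qed.

Lemma lengths_upto_positive n : {subset lengths_upto n <= positive_lengths}.
Proof. by move=> l; rewrite !inE => /andP[]. Qed.

Lemma gseries_eq D (R : comAlgType k) (f g : gseries plus D R) :
  sval f =1 sval g -> f = g.
Proof.
case: f g => f fP [g gP] /= /funext fg; rewrite fg in fP *.
by congr exist; apply: Prop_irrelevance.
Qed.

Lemma coef_truncate D E (DE : {subset D <= E}) (R : comAlgType k)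
    (f : gseries plus E R) w : D (size w) ->
  coef (sval (truncate DE f)) w = coef (sval f) w.
Proof. by move=> Dw; rewrite {1}/coef insubT. Qed.

Lemma size_subword (T : Type) (w : seq T) (V : {set 'I_(size w)}) :
  size (subword V) = #|V|.
Proof. by rewrite size_map cardE. Qed.

Lemma truncate_hom (m : nat) E (DE : {subset lengths_upto m <= E}) :
  group_hom (G := gseries_group plus E) (H := gseries_group plus (lengths_upto m))
    (@truncate plus _ _ DE).
Proof.
split=> [R f g|R R' phi f]; apply: gseries_eq => w /=; last first.
  rewrite /coef; case: insubP => //= /negP[]; apply: DE; exact: (valP w).
have Ew : E (size (val w)) by apply: DE; apply: (valP w).
rewrite -[LHS]/(coef _ (val (Sub (val w) Ew : word s E))) coef_val /boxed /=.
have partE (h : gseries plus E R) (pi : {set {set 'I_(size (val w))}}) :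
    pi \in NC (size (val w)) ->
    coef_part (sval (truncate DE h)) pi = coef_part (sval h) pi.
  rewrite inE => /andP[/and3P[_ _ n0] _]; apply: eq_bigr => V Vpi.
  apply: coef_truncate; rewrite size_subword; apply/andP; split.
    by rewrite card_gt0; apply: contraNneq n0 => <-.
  have /andP[_] := valP w; apply: leq_trans.
  by rewrite -[X in (_ <= X)%N]card_ord max_card.
apply: eq_bigr => pi pP; rewrite (partE _ _ pP); congr (_ * _).
rewrite /kreweras; case: pickP => [sg|_] /=; last by rewrite /coef_part !big_set0.
by rewrite inE => /andP[/andP[sP _] _]; rewrite partE.
Qed.

(* The system of the n-truncated groups for n >= 1; index i stands for n = i+1. *)
Definition tower_stage (i : nat) : group_data k :=
  gseries_group plus (lengths_upto i.+1).

Definition tower_transition (i j : nat) (ij : (i <= j)%N) (R : comAlgType k) :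
  tower_stage j R -> tower_stage i R :=
  @truncate plus _ _ (lengths_upto_leq (ij : i.+1 <= j.+1)%N) R.

Lemma tower_id i (ii : (i <= i)%N) R (x : tower_stage i R) :
  tower_transition ii x = x.
Proof. by apply: gseries_eq => w; rewrite /= coef_val. Qed.

Lemma tower_comp i j l (ij : (i <= j)%N) (jl : (j <= l)%N) (il : (i <= l)%N) R
    (x : tower_stage l R) :
  tower_transition ij (tower_transition jl x) = tower_transition il x.
Proof.
apply: gseries_eq => w; apply: coef_truncate.
exact: (@lengths_upto_leq i.+1 j.+1 ij _ (valP w)).
Qed.

Lemma nat_directed i j : exists l, (i <= l)%N /\ (j <= l)%N.
Proof. by exists (maxn i j); rewrite leq_maxl leq_maxr. Qed.

Definition tower : inverse_system k :=
  @InverseSystem k nat (fun i j => i <= j)%N tower_stage tower_transition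
    (ex_intro _ 0%N I) leqnn (fun i j l ij jl => leq_trans ij jl) nat_directed
    (fun i j ij => truncate_hom _) tower_id tower_comp.

Definition tower_proj (i : nat) (R : comAlgType k) :
  gseries_group plus positive_lengths R -> stage tower i R :=
  @truncate plus _ _ (@lengths_upto_positive i.+1) R.

End Tower.
End GroupSeries.

(* Main.v *)
(* A non-crossing partition is handled through its same-block relation, and K(pi)
   through the criterion: i and j share a block of K(pi) iff the interval ]i, j] is
   a union of blocks of pi.  From it, K is injective, and for a fixed sigma the map
   pi |-> pi /\ K(sigma) is a bijection from {pi >= sigma} onto {tau <= K(sigma)}
   with K(pi) = K(sigma) /\ K(pi /\ K(sigma)); this is the associativity of the
   boxed convolution.  Inverses exist because X_w(f [*] g) is the sum of
   (prod of letters of f) * X_w(g) and terms with shorter words of g.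

   The coordinate ring is a monoid algebra k[M], where M is generated by the X_w
   and the inverses of the X_i.  Give X_w the degree |w| - 1.  Since pi = 0_n is the
   only partition with K(pi) = 1_n, the comultiplication sends a monomial m to
   chi(m) (x) m plus terms whose second factor has lower degree, where
   chi(X_w) = X_i1 .. X_in.  If v_m is the coefficient of a monomial m of highest
   degree in the coaction of v, coassociativity gives rho(v_m) = v_m (x) chi(m), and
   chi(m) = 1 in k[G_+].                                                            *)
Require Import Defs.
From HB Require Import structures.
From mathcomp Require Import all_boot all_order all_algebra.
From mathcomp Require Import boolp.
From mathcomp Require Import zify.

Set Implicit Arguments.
Unset Strict Implicit.
Unset Printing Implicit Defensive.

Import GRing.Theory.
Local Open Scope ring_scope.
Local Open Scope quotient_scope.

(** * Same-block relations and Kreweras complements *)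

(** A factor X_{w|V} of a boxed product is itself a sum over the non-crossing partitions of V.
    Associativity therefore needs Kreweras complements relative to a subset V of the positions, and
    an order embedding that identifies the positions of w|V with V. Only the injectivity of K needs
    an argument on intervals; that K and pi |-> pi /\ K(sigma) are onto follows by counting.

    A monoid algebra serves G and G_+ alike, the latter through the extra relations X_i = 1. Its
    tensor square is replaced by k[M x M], so that coassociativity becomes a comparison of
    coefficients at pairs of monomials. The representation may be infinite-dimensional: the coaction
    of one vector has finitely many non-zero coefficients, which is all that the choice of a highest
    degree requires. Unipotence and trigonalisability are stated for every coordinate ring; each of
    its points is an image of the universal point over k[M], and the eigenvector is transported
    along that map. *)

Section SameBlock.
Variable T : finType.
Implicit Types (sigma tau pi : {set {set T}}) (A V U : {set T}).

Definition same_block sigma (i j : T) : bool :=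
  [exists U in sigma, (i \in U) && (j \in U)].

Lemma same_blockP sigma i j :
  reflect (exists2 U, U \in sigma & (i \in U) && (j \in U)) (same_block sigma i j).
Proof. exact: exists_inP. Qed.

Lemma same_block_sym sigma i j : same_block sigma i j = same_block sigma j i.
Proof. by apply: eq_existsb => U; rewrite (andbC (i \in U)). Qed.

Lemma same_blockE sigma U i j : trivIset sigma -> U \in sigma -> i \in U ->
  same_block sigma i j = (j \in U).
Proof.
move=> tI Us iU; apply/same_blockP/idP => [[W Ws /andP[iW jW]]|jU]; last first.
  by exists U; rewrite ?iU.
by rewrite -(def_pblock tI Us iU) (def_pblock tI Ws iW).
Qed.

Lemma same_block_trans sigma i j l : trivIset sigma ->
  same_block sigma i j -> same_block sigma j l -> same_block sigma i l.
Proof.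
move=> tI /same_blockP[U Us /andP[iU jU]].
by rewrite !(same_blockE _ tI Us).
Qed.

Lemma same_block_refl sigma V i : partition sigma V -> i \in V ->
  same_block sigma i i.
Proof.
move=> /and3P[/eqP<- _ _] /bigcupP[U Us iU].
by apply/same_blockP; exists U; rewrite ?iU.
Qed.

Lemma same_block_in sigma V i j : partition sigma V -> same_block sigma i j ->
  (i \in V) && (j \in V).
Proof.
move=> /and3P[/eqP<- _ _] /same_blockP[U Us /andP[iU jU]].
by apply/andP; split; apply/bigcupP; exists U.
Qed.

Lemma partition_ext sigma tau V : partition sigma V -> partition tau V ->
  (forall i j, i \in V -> j \in V -> same_block sigma i j = same_block tau i j) ->
  sigma = tau.
Proof.
suff H s t : partition s V -> partition t V ->
    (forall i j, i \in V -> j \in V -> same_block s i j = same_block t i j) ->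
    s \subset t.
  by move=> ps pt E; apply/eqP; rewrite eqEsubset !H // => i j iV jV; rewrite E.
move=> ps pt E; have [cs ts s0] := and3P ps; have [ct tt t0] := and3P pt.
apply/subsetP=> U Us; have /set0Pn[i iU]: U != set0 by apply: contraNneq s0 => <-.
have iV : i \in V by rewrite -(eqP cs); apply/bigcupP; exists U.
have: i \in cover t by rewrite (eqP ct).
case/bigcupP=> W Wt iW; suff -> : U = W by [].
apply/setP=> j; rewrite -(same_blockE j ts Us iU) -(same_blockE j tt Wt iW).
have [jV|jV] := boolP (j \in V); first exact: E.
by apply/idP/idP => [/(same_block_in ps)|/(same_block_in pt)]; rewrite (negPf jV) andbF.
Qed.

Lemma partition_equiv (R : rel T) V : {in V & &, equivalence_rel R} ->
  partition (equivalence_partition R V) V /\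
  forall i j, same_block (equivalence_partition R V) i j = [&& i \in V, j \in V & R i j].
Proof.
move=> eqR; have p := equivalence_partitionP eqR; split=> // i j.
have [iV|iV] /= := boolP (i \in V); last first.
  by apply/negbTE; apply: contra iV => /(same_block_in p)/andP[].
have [jV|jV] /= := boolP (j \in V); last first.
  by apply/negbTE; apply: contra jV => /(same_block_in p)/andP[].
have [/eqP cp tp _] := and3P p.
rewrite (@same_blockE _ (pblock (equivalence_partition R V) i)) //.
- by rewrite pblock_equivalence_partition.
- by apply: pblock_mem; rewrite cp.
- by rewrite mem_pblock cp.
Qed.

(** For a partition of the whole set, these are the unions of blocks. A point lying in no block
    imposes no condition, which suits partitions of a subset. *)
Definition saturated sigma A : bool :=
  [forall i, forall j, same_block sigma i j ==> (i \in A) ==> (j \in A)].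

Lemma saturatedP sigma A :
  reflect (forall i j, same_block sigma i j -> i \in A -> j \in A) (saturated sigma A).
Proof.
apply: (iffP forallP) => [H i j ij iA|H i]; last first.
  by apply/forallP=> j; apply/implyP=> ij; apply/implyP; apply: H.
by have /forallP/(_ j)/implyP/(_ ij)/implyP := H i; apply.
Qed.

Definition symdiff A U : {set T} := [set x | (x \in A) (+) (x \in U)].

(** This makes the interval criterion transitive: the symmetric differences attached to (i, j) and
    (j, l) combine to the one attached to (i, l). *)
Lemma saturated_symdiff sigma A U :
  saturated sigma A -> saturated sigma U -> saturated sigma (symdiff A U).
Proof.
move=> /saturatedP sA /saturatedP sU; apply/saturatedP=> i j ij; rewrite !inE.
have ji : same_block sigma j i by rewrite same_block_sym.
have -> : (i \in A) = (j \in A) by apply/idP/idP; apply: sA.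
by have -> : (i \in U) = (j \in U) by apply/idP/idP; apply: sU.
Qed.

End SameBlock.

(** * Relative Kreweras complements through the interval criterion *)

Section Krew.
Variable n : nat.
Implicit Types (i j x y : 'I_n) (sigma tau pi rho : {set {set 'I_n}}) (V : {set 'I_n}).

Lemma refinesP sigma pi : partition sigma setT -> partition pi setT ->
  reflect (forall i j, same_block sigma i j -> same_block pi i j) (refines sigma pi).
Proof.
move=> ps pp; have [cs ts s0] := and3P ps; have [cp tp _] := and3P pp.
apply: (iffP forall_inP) => [H i j /same_blockP[U /H/exists_inP[W Wp /subsetP UW]]|H U Us].
  by case/andP=> /UW iW /UW jW; apply/same_blockP; exists W; rewrite ?iW.
have /set0Pn[i iU]: U != set0 by apply: contraNneq s0 => <-.
have: i \in cover pi by rewrite (eqP cp).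
case/bigcupP=> W Wp iW; apply/exists_inP; exists W => //.
apply/subsetP=> j jU; rewrite -(same_blockE j tp Wp iW); apply: H.
by rewrite (same_blockE j ts Us iU).
Qed.

Definition NCV V : {set {set {set 'I_n}}} :=
  [set sigma | partition sigma V & noncrossing sigma].

Lemma NCVP V sigma : partition sigma V ->
  reflect (forall a b c d : 'I_n, (a < b)%N -> (b < c)%N -> (c < d)%N ->
     same_block sigma a c -> same_block sigma b d -> same_block sigma a b)
  (noncrossing sigma).
Proof.
move=> /and3P[_ tI _]; apply: (iffP forall_inP) => [H a b c d ab bc cd|H U Us].
  case/same_blockP=> U Us /andP[aU cU] /same_blockP[W Ws /andP[bW dW]].
  rewrite (same_blockE _ tI Us) //; have [->//|UW] := eqVneq U W.
  have /forall_inP/(_ W Ws)/implyP/(_ UW)/negP[] := H _ Us.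
  apply/existsP; exists a; rewrite aU; apply/existsP; exists b; rewrite bW.
  by apply/existsP; exists c; rewrite cU; apply/existsP; exists d; rewrite dW ab bc cd.
apply/forall_inP=> W Ws; apply/implyP=> UW; apply/negP.
case/existsP=> a /andP[aU] /existsP[b /andP[bW]] /existsP[c /andP[cU]] /existsP[d /andP[dW]].
case/and3P=> ab bc cd; have := H _ _ _ _ ab bc cd.
rewrite (same_blockE _ tI Us) // (same_blockE _ tI Ws) // => /(_ cU dW).
rewrite (same_blockE _ tI Us) // => bU.
by case/negP: UW; apply/eqP; rewrite -(def_pblock tI Us bU) (def_pblock tI Ws bW).
Qed.

Definition upto V i : {set 'I_n} := [set x in V | (x <= i)%N].

(** The plain points between bar i and bar j are exactly those of ]i, j], whence the half-open
    interval. Writing it as a symmetric difference of two initial segments of V frees the relation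
    from the order of i and j. *)
Definition krel V sigma i j : bool := saturated sigma (symdiff (upto V i) (upto V j)).

Lemma krelC V sigma i j : krel V sigma i j = krel V sigma j i.
Proof. by congr saturated; apply/setP=> x; rewrite !inE addbC. Qed.

Lemma krel_equiv V sigma : equivalence_rel (krel V sigma).
Proof.
have refl : reflexive (krel V sigma).
  by move=> i; apply/saturatedP=> a b _; rewrite !inE addbb.
have tr : transitive (krel V sigma).
  move=> j i l ij jl; rewrite /krel; have := saturated_symdiff ij jl.
  by congr saturated; apply/setP=> x; rewrite !inE -addbA addKb.
move=> i j l; split=> // ij; apply/idP/idP; last exact: tr.
by apply: tr; rewrite krelC.
Qed.

Lemma krel_ltP V sigma i j : (i <= j)%N ->
  reflect (forall x y, same_block sigma x y -> x \in V -> (i < x <= j)%N ->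
             (y \in V) && (i < y <= j)%N)
    (krel V sigma i j).
Proof.
move=> ij; have E x : (x \in symdiff (upto V i) (upto V j)) = (x \in V) && (i < x <= j)%N.
  by rewrite !inE; case: (x \in V) => //=; lia.
apply: (iffP (saturatedP _ _)) => H x y xy.
  by move=> xV xij; have := H x y xy; rewrite !E xV xij; apply.
by rewrite !E => /andP[]; apply: H.
Qed.

Definition krew V sigma := equivalence_partition (krel V sigma) V.

Lemma krew_partition V sigma : partition (krew V sigma) V.
Proof.
by case: (partition_equiv (R := krel V sigma) (V := V)) => // ? ? ? _ _ _; apply: krel_equiv.
Qed.

Lemma same_block_krew V sigma i j :
  same_block (krew V sigma) i j = [&& i \in V, j \in V & krel V sigma i j].
Proof.
by case: (partition_equiv (R := krel V sigma) (V := V)) => // ? ? ? _ _ _; apply: krel_equiv.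
Qed.

(** Let a < b < c < d, with ]a, c] and ]b, d] unions of blocks. A block meeting ]a, b] stays in ]a,
    c] and, having a point outside ]b, d], never enters it; so ]a, b] is a union of blocks too. *)
Lemma krew_NCV V sigma : krew V sigma \in NCV V.
Proof.
rewrite inE krew_partition; apply/(NCVP (krew_partition V sigma)) => a b c d ab bc cd.
rewrite !same_block_krew => /and3P[aV cV /krel_ltP ac] /and3P[bV dV /krel_ltP bd].
rewrite aV bV; apply/krel_ltP; first lia.
move=> x y xy xV xab; have xac : (a < x <= c)%N by lia.
have /andP[yV yac] := ac (ltac:(lia)) _ _ xy xV xac; rewrite yV /=.
have [ybd|] := boolP (b < y <= d)%N; last lia.
by have := bd (ltac:(lia)) y x; rewrite same_block_sym yV ybd => /(_ xy isT isT); lia.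
Qed.

End Krew.

(** * The interval criterion yields the greatest compatible partition *)

Section Interlace.
Variable n : nat.
Implicit Types (i j x y : 'I_n) (sigma tau pi rho : {set {set 'I_n}}) (V : {set 'I_n}).

Lemma plain_inj : injective (@plain n).
Proof. by move=> i j /(congr1 val)/= /double_inj/val_inj. Qed.

Lemma bar_inj : injective (@bar n).
Proof. by move=> i j /(congr1 val)/= [] /double_inj/val_inj. Qed.

Lemma plain_bar i j : (plain i == bar j) = false.
Proof. by apply/eqP=> /(congr1 (odd \o val)) /=; rewrite !odd_double. Qed.

Variant position_spec : 'I_n.*2 -> Type :=
| PositionPlain i : position_spec (plain i)
| PositionBar i : position_spec (bar i).

Lemma positionP p : position_spec p.
Proof.
have lt : (p./2 < n)%N by have := ltn_ord p; lia.
have [o|o] := boolP (odd p).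
  suff -> : p = bar (Ordinal lt) by constructor.
  by apply: val_inj => /=; have := odd_double_half p; rewrite o.
suff -> : p = plain (Ordinal lt) by constructor.
by apply: val_inj => /=; have := odd_double_half p; rewrite (negPf o).
Qed.

Lemma plain_in_bar i V : (plain i \in [set bar x | x in V]) = false.
Proof. by apply/negbTE/imsetP=> -[j _] /eqP; rewrite plain_bar. Qed.

Lemma bar_in_plain i V : (bar i \in [set plain x | x in V]) = false.
Proof. by apply/negbTE/imsetP=> -[j _] /eqP; rewrite eq_sym plain_bar. Qed.

Definition inE_interlace :=
  (plain_in_bar, bar_in_plain,
   fun (A : {set 'I_n}) x => mem_imset A x plain_inj,
   fun (A : {set 'I_n}) x => mem_imset A x bar_inj).

Lemma in_interlaceP pi sigma U :
  reflect ((exists2 V, V \in pi & U = [set plain x | x in V]) \/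
           (exists2 V, V \in sigma & U = [set bar x | x in V]))
    (U \in interlace pi sigma).
Proof.
rewrite inE; apply: (iffP orP) => -[H|H]; [left|right|left|right].
- by case/imsetP: H => V Vp ->; exists V.
- by case/imsetP: H => V Vp ->; exists V.
- by case: H => V Vp ->; apply: imset_f.
- by case: H => V Vp ->; apply: imset_f.
Qed.

Lemma same_block_interlace pi sigma :
  [/\ forall i j, same_block (interlace pi sigma) (plain i) (plain j) = same_block pi i j,
      forall i j, same_block (interlace pi sigma) (bar i) (bar j) = same_block sigma i j,
      forall i j, same_block (interlace pi sigma) (plain i) (bar j) = false
    & forall i j, same_block (interlace pi sigma) (bar i) (plain j) = false].
Proof.
have key (i j : 'I_n.*2) := same_blockP (interlace pi sigma) i j.
split=> i j.
- apply/key/same_blockP=> -[U].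
    by case/in_interlaceP=> -[V Vp ->]; rewrite !inE_interlace // => ij; exists V.
  move=> Up ij; exists [set plain x | x in U]; last by rewrite !inE_interlace.
  by apply/in_interlaceP; left; exists U.
- apply/key/same_blockP=> -[U].
    by case/in_interlaceP=> -[V Vp ->]; rewrite !inE_interlace // => ij; exists V.
  move=> Up ij; exists [set bar x | x in U]; last by rewrite !inE_interlace.
  by apply/in_interlaceP; right; exists U.
- by apply/key=> -[U]/in_interlaceP[] [V Vp ->]; rewrite !inE_interlace // andbF.
- by apply/key=> -[U]/in_interlaceP[] [V Vp ->]; rewrite !inE_interlace // andbF.
Qed.

Lemma interlace_partition pi sigma : partition pi setT -> partition sigma setT ->
  partition (interlace pi sigma) setT.
Proof.
move=> /and3P[/eqP cp tp p0] /and3P[/eqP cs ts s0]; apply/and3P; split.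
- apply/eqP/setP=> p; rewrite inE; apply/bigcupP; case: (positionP p) => i.
    have: i \in cover pi by rewrite cp inE.
    case/bigcupP=> V Vp iV; exists [set plain x | x in V]; last by rewrite inE_interlace.
    by apply/in_interlaceP; left; exists V.
  have: i \in cover sigma by rewrite cs inE.
  case/bigcupP=> V Vp iV; exists [set bar x | x in V]; last by rewrite inE_interlace.
  by apply/in_interlaceP; right; exists V.
- apply/trivIsetP=> A B /in_interlaceP[] [V Vp ->] /in_interlaceP[] [W Wp ->] VW;
    apply/pred0Pn=> -[p]; case: (positionP p) => i; rewrite /= !inE_interlace ?andbF //;
    move=> /andP[iV iW]; case/negP: VW; apply/eqP; congr imset.
  + by rewrite -(def_pblock tp Vp iV) (def_pblock tp Wp iW).
  + by rewrite -(def_pblock ts Vp iV) (def_pblock ts Wp iW).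
- apply/in_interlaceP=> -[] [V Vp /esym/eqP]; rewrite -cards_eq0 card_imset;
    [|exact: plain_inj| |exact: bar_inj]; rewrite cards_eq0 => /eqP V0; move: Vp; rewrite V0.
  + by rewrite (negPf p0).
  + by rewrite (negPf s0).
Qed.

(** Plain points do not cross each other, nor do barred ones. A mixed crossing would put exactly one
    of two points of a block of [pi] into an interval ]i, j] that is a union of blocks of [pi]. *)
Lemma interlace_krew pi : pi \in NC n -> interlace pi (krew setT pi) \in NC n.*2.
Proof.
rewrite !inE => /andP[pp /(NCVP pp) np].
have := krew_NCV setT pi; rewrite inE => /andP[pk /(NCVP pk) nk].
have pI := interlace_partition pp pk; rewrite pI; apply/(NCVP pI) => a b c d.
have [E1 E2 E3 E4] := same_block_interlace pi (krew setT pi).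
case: (positionP a) => a'; case: (positionP b) => b'; case: (positionP c) => c';
  case: (positionP d) => d' /=; rewrite ?E1 ?E2 ?E3 ?E4 //.
- by rewrite !ltn_double => ab bc cd; apply: np ab bc cd.
- move=> ab bc cd ac; rewrite same_block_krew !inE /= => /krel_ltP H.
  have := H (ltac:(lia)) c' a'; rewrite same_block_sym ac inE => /(_ isT isT); lia.
- move=> ab bc cd; rewrite same_block_krew !inE /= => /krel_ltP H bd.
  have := H (ltac:(lia)) b' d'; rewrite bd inE => /(_ isT isT); lia.
- by rewrite !ltnS !ltn_double => ab bc cd; apply: nk ab bc cd.
Qed.

(** This is the maximality of the complement: if x in ]i, j] shares a block of [pi] with some y
    outside, then plain x and plain y cross bar i and bar j. *)
Lemma interlace_krel pi tau : partition pi setT -> partition tau setT ->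
  interlace pi tau \in NC n.*2 ->
  forall i j, same_block tau i j -> krel setT pi i j.
Proof.
move=> pp pt; rewrite inE => /andP[pI /(NCVP pI) nI].
have [E1 E2 E3 E4] := same_block_interlace pi tau.
have W i j : (i <= j)%N -> same_block tau i j -> krel setT pi i j.
  move=> le ij; apply/krel_ltP=> // x y xy _ xij; rewrite inE /=.
  have [//|] := boolP (i < y <= j)%N; have [yi|yi] := leqP y i => yij.
    have := nI (plain y) (bar i) (plain x) (bar j).
    by rewrite E1 E2 E3 same_block_sym /= => H; apply: H => //; lia.
  have := nI (bar i) (plain x) (bar j) (plain y).
  by rewrite E1 E2 E4 /= => H; apply: H => //; lia.
move=> i j ij; have [le|/ltnW le] := leqP i j; first exact: W.
by rewrite krelC; apply: W; rewrite // same_block_sym.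
Qed.

Lemma kreweras_krew pi : pi \in NC n -> kreweras pi = krew setT pi.
Proof.
move=> pNC; have := pNC; rewrite inE => /andP[pp _].
have kc : krew setT pi \in kreweras_compatible pi.
  by rewrite inE interlace_krew // andbT; apply: krew_NCV.
have kmax tau : tau \in kreweras_compatible pi -> refines tau (krew setT pi).
  rewrite inE => /andP[]; rewrite inE => /andP[pt _] /(interlace_krel pp pt) H.
  by apply/refinesP=> //= [|i j /H]; rewrite ?krew_partition // same_block_krew !inE.
(* The picked partition and [krew setT pi] are both greatest, so they refine each other and
   coincide; the second branch shows that the default is not reached. *)
rewrite /kreweras; case: pickP => [sigma /andP[sc /forall_inP smax]|/(_ (krew setT pi))].
  have := sc; rewrite inE => /andP[]; rewrite inE => /andP[ps _] _.
  apply: (partition_ext ps (krew_partition _ _)) => i j _ _ /=.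
  apply/idP/idP; first by move: i j; apply/refinesP; rewrite ?krew_partition ?kmax.
  by move: i j; apply/refinesP; rewrite ?krew_partition ?smax.
by rewrite kc /= => /negP[]; apply/forall_inP=> tau; apply: kmax.
Qed.

End Interlace.

(** * Meets, and the decomposition of K(pi) over a partition below pi *)

Section Lattice.
Variable n : nat.
Implicit Types (i j x y : 'I_n) (sigma tau pi rho : {set {set 'I_n}}) (V : {set 'I_n}).

Lemma NC_partition pi : pi \in NC n -> partition pi setT.
Proof. by rewrite inE => /andP[]. Qed.

Lemma NC_noncrossing pi : pi \in NC n -> forall a b c d : 'I_n,
  (a < b)%N -> (b < c)%N -> (c < d)%N ->
  same_block pi a c -> same_block pi b d -> same_block pi a b.
Proof. by rewrite inE => /andP[p /(NCVP p)]. Qed.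

Lemma NC_trans pi : pi \in NC n -> transitive (same_block pi).
Proof. by move=> /NC_partition/and3P[_ tI _] j i l; apply: same_block_trans. Qed.

Lemma NC_left pi i j l : pi \in NC n -> same_block pi i j ->
  same_block pi i l = same_block pi j l.
Proof.
move=> pN ij; apply/idP/idP; last exact: NC_trans ij.
by apply: NC_trans => //; rewrite same_block_sym.
Qed.

Lemma NC_refl pi : pi \in NC n -> reflexive (same_block pi).
Proof. by move=> /NC_partition p i; apply: (same_block_refl p); rewrite inE. Qed.

Lemma krew_NC pi : krew setT pi \in NC n.
Proof. exact: krew_NCV. Qed.

Lemma same_block_krewT pi i j : same_block (krew setT pi) i j = krel setT pi i j.
Proof. by rewrite same_block_krew !inE. Qed.

Lemma NC_ext pi rho : pi \in NC n -> rho \in NC n ->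
  (forall i j, (i < j)%N -> same_block pi i j = same_block rho i j) -> pi = rho.
Proof.
move=> pN rN E; apply: (partition_ext (NC_partition pN) (NC_partition rN)).
move=> i j _ _; case: (ltngtP i j) => [/E//|ji|/val_inj->].
  by rewrite [LHS]same_block_sym [RHS]same_block_sym E.
by rewrite !NC_refl.
Qed.

Lemma krelT_ltP sigma i j : (i <= j)%N ->
  reflect (forall x y, same_block sigma x y -> (i < x <= j)%N -> (i < y <= j)%N)
    (krel setT sigma i j).
Proof.
move=> ij; apply: (iffP (krel_ltP _ _ ij)) => H x y xy.
  by move=> xij; have := H x y xy; rewrite !inE; apply.
by rewrite !inE => _; apply: H.
Qed.

Definition meet pi rho : {set {set 'I_n}} :=
  equivalence_partition (fun i j => same_block pi i j && same_block rho i j) setT.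

Lemma meet_spec pi rho : pi \in NC n -> rho \in NC n ->
  partition (meet pi rho) setT /\
  forall i j, same_block (meet pi rho) i j = same_block pi i j && same_block rho i j.
Proof.
move=> pN rN; case: (partition_equiv (T := 'I_n) (V := setT)
    (R := fun i j => same_block pi i j && same_block rho i j)).
  move=> i j l _ _ _; rewrite !NC_refl //; split=> // /andP[ij ij'].
  by rewrite (NC_left l pN ij) (NC_left l rN ij').
by move=> H E; split=> // i j; rewrite E !inE.
Qed.

Lemma same_block_meet pi rho i j : pi \in NC n -> rho \in NC n ->
  same_block (meet pi rho) i j = same_block pi i j && same_block rho i j.
Proof. by move=> pN rN; case: (meet_spec pN rN). Qed.

Lemma meet_NC pi rho : pi \in NC n -> rho \in NC n -> meet pi rho \in NC n.
Proof.
move=> pN rN; have [p E] := meet_spec pN rN; rewrite inE p; apply/(NCVP p).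
move=> a b c d ab bc cd; rewrite !E => /andP[ac ac'] /andP[bd bd'].
by rewrite (NC_noncrossing pN ab bc cd) // (NC_noncrossing rN ab bc cd).
Qed.

Definition below sigma pi : bool :=
  [forall i, forall j, same_block sigma i j ==> same_block pi i j].

Lemma belowP sigma pi :
  reflect (forall i j, same_block sigma i j -> same_block pi i j) (below sigma pi).
Proof.
apply: (iffP forallP) => [H i j|H i]; first by have /forallP/(_ j)/implyP := H i.
by apply/forallP=> j; apply/implyP; apply: H.
Qed.

Lemma krel_below sigma pi i j : below sigma pi -> krel setT pi i j -> krel setT sigma i j.
Proof.
move=> /belowP sp /saturatedP H; apply/saturatedP=> x y /sp; exact: H.
Qed.

(* A point of ]i, j] outside the pi-block of i lies in a gap of that block,     *)
(* together with its whole sigma-block.                                        *)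
Lemma krel_restrict sigma pi i j : pi \in NC n -> below sigma pi ->
  same_block pi i j -> (i <= j)%N ->
  (forall x y, same_block sigma x y -> same_block pi i x -> (i < x <= j)%N ->
     (i < y <= j)%N) -> krel setT sigma i j.
Proof.
move=> pN /belowP sp ij le H; apply/krelT_ltP=> // x y xy xij.
have [ix|nix] := boolP (same_block pi i x); first exact: H xy ix xij.
have xyp := sp _ _ xy.
have xj : x != j by apply: contraNneq nix => ->.
have yi : y != i by apply: contraNneq nix => <-; rewrite same_block_sym.
have yj : y != j.
  by apply: contraNneq nix => yj; apply: NC_trans ij _; rewrite // -yj same_block_sym.
have [//|nyij] := boolP (i < y <= j)%N; have [yi'|yi'] := ltnP y i.
  case/negP: nix; rewrite same_block_sym; apply: (NC_trans pN (y := y)) => //.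
  apply: (NC_noncrossing pN (c := x) (d := j)) => //; try lia.
    by move: xj; rewrite -val_eqE /=; lia.
  by rewrite same_block_sym.
case/negP: nix; apply: (NC_noncrossing pN (c := j) (d := y)) => //; try lia.
  by move: xj; rewrite -val_eqE /=; lia.
by move: yj yi xij; rewrite -!val_eqE /=; lia.
Qed.

(** The forward direction is monotonicity, [sigma] and the meet both lying below [pi]. Conversely,
    suppose that x in ]i, j] and y outside share a block of [pi]. Two points of that block, one
    inside ]i, j] and one outside, are found that bound a union of blocks of [sigma]; they share a
    block of the meet, against the hypothesis on ]i, j]. By [krel_restrict], only the points of this
    one block of [pi] need checking. *)
Lemma krew_meet sigma pi i j : sigma \in NC n -> pi \in NC n -> below sigma pi ->
  krel setT pi i j =
  krel setT sigma i j && krel setT (meet pi (krew setT sigma)) i j.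
Proof.
move=> sN pN sp; have kN := krew_NC sigma.
have mE x y : same_block (meet pi (krew setT sigma)) x y =
    same_block pi x y && krel setT sigma x y.
  by rewrite same_block_meet // same_block_krewT.
apply/idP/andP=> [pij|[sij tij]].
  split; first exact: krel_below pij.
  by apply: krel_below pij; apply/belowP=> x y; rewrite mE => /andP[].
wlog le : i j sij tij / (i <= j)%N.
  move=> H; have [le|/ltnW le] := leqP i j; first exact: H.
  by rewrite krelC; apply: H; rewrite // krelC.
apply/krelT_ltP=> // x y xy xij; have [//|yij] := boolP (i < y <= j)%N.
move: sij tij => /(krelT_ltP _ le) sij /(krelT_ltP _ le) tij.
have sip := belowP _ _ sp.
have tr := NC_trans pN.
have [b /andP[bx bij] bmax] : exists2 b, same_block pi x b && (i < b <= j)%N &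
    forall z, same_block pi x z -> (i < z <= j)%N -> (z <= b)%N.
  have := @arg_maxnP _ x (fun z => same_block pi x z && (i < z <= j)%N) (@nat_of_ord n).
  rewrite NC_refl // => /(_ xij)[b bP bmax]; exists b => // z xz zij.
  by apply: bmax; rewrite xz.
(* If the block of x has points up to i, let a' be the last of them. A block of [sigma] through a
   point of that block in ]a', b] stays in ]i, j], hence in ]a', b] by the choice of b. *)
have [a /andP[xa ai]|noa] := pickP (fun z => same_block pi x z && (z <= i)%N).
  have [a' /andP[ax' ai'] amax] : exists2 a, same_block pi x a && (a <= i)%N &
      forall z, same_block pi x z -> (z <= i)%N -> (z <= a)%N.
    have := @arg_maxnP _ a (fun z => same_block pi x z && (z <= i)%N) (@nat_of_ord n).
    rewrite xa => /(_ ai)[a' aP amax]; exists a' => // z xz zi.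
    by apply: amax; rewrite xz.
  have ab : same_block pi a' b by apply: tr bx; rewrite same_block_sym.
  have kab : krel setT sigma a' b.
    apply: (krel_restrict pN sp ab) => [|u v uv au uab].
      by move: ai' bij; clear; lia.
    have xu := tr _ _ _ ax' au; have xv := tr _ _ _ xu (sip _ _ uv).
    have ui : (i < u <= j)%N by move: (amax _ xu) uab bij; clear; lia.
    have vi := sij _ _ uv ui; move: ai' vi (bmax _ xv vi); clear; lia.
  have := tij b a'; rewrite same_block_sym mE ab kab => /(_ isT bij).
  by move: ai'; clear; lia.
(* Otherwise y lies beyond j, and b is paired with the last point m of the whole block. *)
have noa' z : same_block pi x z -> (i < z)%N.
  by move=> xz; have := noa z; rewrite xz /= leqNgt => /negbFE.
have yi := noa' _ xy.
have [m xm mmax] : exists2 m, same_block pi x m &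
    forall z, same_block pi x z -> (z <= m)%N.
  have := @arg_maxnP _ x (fun z => same_block pi x z) (@nat_of_ord n).
  by rewrite NC_refl // => /(_ isT)[m mP mmax]; exists m.
have ym := mmax _ xy.
have bm : same_block pi b m by apply: tr xm; rewrite same_block_sym.
have kbm : krel setT sigma b m.
  apply: (krel_restrict pN sp bm) => [|u v uv bu ubm].
    by move: yij yi ym bij; clear; lia.
  have xu := tr _ _ _ bx bu; have xv := tr _ _ _ xu (sip _ _ uv).
  rewrite (mmax _ xv) andbT ltnNge; apply/negP=> vb.
  have vij : (i < v <= j)%N by move: (noa' _ xv) vb bij; clear; lia.
  have := sij v u; rewrite same_block_sym => /(_ uv vij) uij.
  by move: ubm (bmax _ xu uij); clear; lia.
have := tij b m; rewrite mE bm kbm => /(_ isT bij).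
by move: yij yi ym; clear; lia.
Qed.

End Lattice.

(** * Bijectivity of K and of the relative complement *)

Section Bijection.
Variable n : nat.
Implicit Types (i j x y : 'I_n) (sigma tau pi rho : {set {set 'I_n}}) (V : {set 'I_n}).

(** The dual interval criterion: the bars between plain i and plain j are those of [i, j[. If i and
    j lie in different blocks, some block of K(pi) must leave [i, j[; the proof always exhibits one
    through w, the last point before j in the block of i. *)
Lemma krew_recover pi i j : pi \in NC n -> (i < j)%N ->
  same_block pi i j =
  saturated (krew setT pi) [set x : 'I_n | (i <= x < j)%N].
Proof.
move=> pN ij; have tr := NC_trans pN; apply/idP/idP => [pij|/saturatedP sat].
  apply/saturatedP=> x y; rewrite same_block_krewT !inE => xy xij.
  have [//|yij] := boolP (i <= y < j)%N; have [yx|xy'] := ltnP y x.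
    move: xy; rewrite krelC => /krelT_ltP-/(_ (ltnW yx))/(_ i j pij).
    by move: yx xij yij; clear; lia.
  move: xy => /krelT_ltP-/(_ xy')/(_ j i); rewrite same_block_sym => /(_ pij).
  by move: xy' xij yij; clear; lia.
have satF (a b : 'I_n) : (i <= a < j)%N -> ~~ (i <= b < j)%N -> krel setT pi a b -> False.
  move=> aij bij ab; have := sat a b; rewrite same_block_krewT ab !inE => /(_ isT aij).
  by rewrite (negPf bij).
have [//|nij] := boolP (same_block pi i j); exfalso.
have [w /andP[iw wj] wmax] : exists2 w, same_block pi i w && (w < j)%N &
    forall z, same_block pi i z -> (z < j)%N -> (z <= w)%N.
  have := @arg_maxnP _ i (fun z => same_block pi i z && (z < j)%N) (@nat_of_ord n).
  rewrite NC_refl // => /(_ ij)[w wP wmax]; exists w => // z iz zj.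
  by apply: wmax; rewrite iz.
have iw' : (i <= w < j)%N by rewrite wj wmax // NC_refl.
have neq z : same_block pi i z -> z != j by apply: contraTneq => ->.
(* If the block of i continues past j, then w and w2 are consecutive in it. The gap between them is
   a union of blocks, so K(pi) joins w to w2 - 1, which is at least j. *)
have [w1 /andP[iw1 jw1]|no] := pickP (fun z => same_block pi i z && (j < z)%N).
  have [w2 /andP[iw2 jw2] w2min] : exists2 w, same_block pi i w && (j < w)%N &
      forall z, same_block pi i z -> (j < z)%N -> (w <= z)%N.
    have := @arg_minnP _ w1 (fun z => same_block pi i z && (j < z)%N) (@nat_of_ord n).
    rewrite iw1 => /(_ jw1)[w2 w2P w2min]; exists w2 => // z iz zj.
    by apply: w2min; rewrite iz.
  have ww2 : same_block pi w w2 by rewrite -(NC_left _ pN iw).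
  have gap (z : 'I_n) : (w < z)%N -> (z < w2)%N -> ~~ same_block pi i z.
    move=> wz zw2; apply/negP=> iz; have := neq _ iz; rewrite -val_eqE /=.
    by move: wz zw2 (wmax _ iz) (w2min _ iz); clear; lia.
  have lt : (w2.-1 < n)%N by apply: leq_ltn_trans (ltn_ord w2); apply: leq_pred.
  apply: (satF w (Ordinal lt)) => //; first by move: jw2 => /=; clear; lia.
  apply/krelT_ltP=> /= [|x y xy xw].
    by move: jw2 wj; clear; lia.
  have nix : ~~ same_block pi i x by apply: gap; move: xw jw2; clear; lia.
  have niy : ~~ same_block pi i y by apply: contra nix => iy; apply: tr iy _; rewrite same_block_sym.
  have yw : y != w by apply: contraNneq niy => ->.
  have yw2 : y != w2 by apply: contraNneq niy => ->.
  have [//|yn] := boolP (w < y <= w2.-1)%N; move: yw yw2; rewrite -!val_eqE /= => yw yw2.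
  have [yw'|wy] := ltnP y w.
    have := NC_noncrossing pN (a := y) (b := w) (c := x) (d := w2).
    rewrite same_block_sym xy ww2 => H; case/negP: niy.
    rewrite (NC_left _ pN iw) same_block_sym.
    by apply: H => //; move: xw jw2; clear; lia.
  have := NC_noncrossing pN (a := w) (b := x) (c := w2) (d := y).
  rewrite ww2 xy => H; case/negP: nix; rewrite (NC_left _ pN iw).
  by apply: H => //; move: xw yn yw yw2 wy jw2; clear; lia.
(* Now the block of i ends at w. Its hull [m, w] is a union of blocks, so K(pi) joins w to m - 1,
   which is below i. *)
have all_lt z : same_block pi i z -> (z < j)%N.
  by move=> iz; have := no z; have := neq _ iz; rewrite iz -val_eqE /=; clear; lia.
have wmax' z : same_block pi i z -> (z <= w)%N by move=> iz; apply/wmax/all_lt.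
have [m im mmin] : exists2 m, same_block pi i m &
    forall z, same_block pi i z -> (m <= z)%N.
  have := @arg_minnP _ i (fun z => same_block pi i z) (@nat_of_ord n).
  by rewrite NC_refl // => /(_ isT)[m mP mmin]; exists m.
have mi : (m <= i)%N by rewrite mmin // NC_refl.
have wm : same_block pi m w by rewrite -(NC_left _ pN im).
have hull x y : same_block pi x y -> (m <= x <= w)%N -> (m <= y <= w)%N.
  move=> xy xmw; have [ix|nix] := boolP (same_block pi i x).
    by have iy := tr _ _ _ ix xy; rewrite mmin ?wmax'.
  have niy : ~~ same_block pi i y by apply: contra nix => iy; apply: tr iy _; rewrite same_block_sym.
  have xm : x != m by apply: contraNneq nix => ->.
  have xw : x != w by apply: contraNneq nix => ->.
  have ym : y != m by apply: contraNneq niy => ->.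
  have yw : y != w by apply: contraNneq niy => ->.
  have [//|yn] := boolP (m <= y <= w)%N; move: xm xw ym yw; rewrite -!val_eqE /=.
  move=> xm xw ym yw; have [ym'|my] := ltnP y m.
    have := NC_noncrossing pN (a := y) (b := m) (c := x) (d := w).
    rewrite same_block_sym xy wm => H; case/negP: niy.
    rewrite (NC_left _ pN im) same_block_sym.
    by apply: H => //; move: xm xw xmw; clear; lia.
  have := NC_noncrossing pN (a := m) (b := x) (c := w) (d := y).
  rewrite wm xy => H; case/negP: nix; rewrite (NC_left _ pN im).
  by apply: H => //; move: xm xw xmw ym yw my yn; clear; lia.
(* No bar precedes position 0. In that case the complement ]w, n - 1] of the hull is a union of
   blocks and joins w to the last bar. *)
have [m0|m0] := posnP m.
  have lt : (n.-1 < n)%N by have := ltn_ord i; clear; lia.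
  apply: (satF w (Ordinal lt)) => //=.
    by have := ltn_ord j; clear; lia.
  apply/krelT_ltP=> /= [|x y xy xw]; first by have := ltn_ord w; clear; lia.
  have [yw|] := leqP y w; last by have := ltn_ord y; clear; lia.
  by have := hull y x; rewrite same_block_sym m0 => /(_ xy yw); move: xw; clear; lia.
have lt : (m.-1 < n)%N by apply: leq_ltn_trans (ltn_ord m); apply: leq_pred.
apply: (satF w (Ordinal lt)) => //=; first by move: m0 mi; clear; lia.
rewrite krelC; apply/krelT_ltP=> /= [|x y xy xw].
  by move: mi iw'; clear; lia.
by have := hull x y xy; move: xw m0; clear; lia.
Qed.

Lemma krew_inj : {in NC n &, injective (krew setT)}.
Proof.
move=> pi rho pN rN E; apply: (NC_ext pN rN) => i j ij.
by rewrite (krew_recover pN ij) (krew_recover rN ij) E.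
Qed.

(** An injective self-map of a finite set is onto. *)
Lemma krew_image : [set krew setT pi | pi in NC n] = NC n.
Proof.
apply/eqP; rewrite eqEcard card_in_imset ?leqnn ?andbT; last exact: krew_inj.
by apply/subsetP=> _ /imsetP[pi _ ->]; apply: krew_NC.
Qed.

(** Each of pi and K(pi) is read off from the other by an interval criterion, and a finer partition
    has more saturated sets. *)
Lemma below_krew sigma pi : sigma \in NC n -> pi \in NC n ->
  below (krew setT pi) (krew setT sigma) = below sigma pi.
Proof.
move=> sN pN; apply/idP/idP => [/belowP H|sp]; apply/belowP.
  have W i j : (i < j)%N -> same_block sigma i j -> same_block pi i j.
    move=> ij; rewrite (krew_recover sN ij) (krew_recover pN ij) => /saturatedP sat.
    by apply/saturatedP=> x y /H; apply: sat.
  move=> i j; case: (ltngtP i j) => [/W//|ji|/val_inj->]; last by rewrite !NC_refl.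
  by rewrite ![same_block _ i j]same_block_sym; apply: W.
by move=> i j; rewrite !same_block_krewT; apply: krel_below sp.
Qed.

Lemma meet_below pi rho : pi \in NC n -> rho \in NC n -> below (meet pi rho) rho.
Proof. by move=> pN rN; apply/belowP=> i j; rewrite same_block_meet // => /andP[]. Qed.

Lemma meetC pi rho : meet pi rho = meet rho pi.
Proof.
by congr equivalence_partition; apply/funext=> i; apply/funext=> j; rewrite andbC.
Qed.

Lemma krew_relative sigma pi : sigma \in NC n -> pi \in NC n -> below sigma pi ->
  krew setT pi = meet (krew setT sigma) (krew setT (meet pi (krew setT sigma))).
Proof.
move=> sN pN sp; have kN := krew_NC sigma; have mN := meet_NC pN kN.
apply: NC_ext; rewrite ?krew_NC ?meet_NC ?krew_NC // => i j _.
by rewrite same_block_meet ?krew_NC // !same_block_krewT -krew_meet.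
Qed.

(** Injective because [krew_relative] computes K(pi) from the meet and K is injective. Onto by
    counting: K reverses the order, hence matches the partitions above [sigma] with those below
    K(sigma). *)
Lemma meet_krew_image sigma : sigma \in NC n ->
  {in [set pi in NC n | below sigma pi] &,
     injective (fun pi => meet pi (krew setT sigma))} /\
  [set meet pi (krew setT sigma) | pi in [set pi in NC n | below sigma pi]] =
  [set tau in NC n | below tau (krew setT sigma)].
Proof.
move=> sN; have kN := krew_NC sigma; set P := [set pi in _ | _].
have inj : {in P &, injective (fun pi => meet pi (krew setT sigma))}.
  move=> pi rho /setIdP[pN sp] /setIdP[rN sr] /= E.
  by apply: (krew_inj pN rN); rewrite (krew_relative sN pN sp) (krew_relative sN rN sr) E.
split=> //; apply/eqP; rewrite eqEcard card_in_imset //; apply/andP; split.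
  by apply/subsetP=> _ /imsetP[pi /setIdP[pN _] ->]; apply/setIdP; rewrite meet_NC ?meet_below.
rewrite -(card_in_imset (f := krew setT) (D := P)); last first.
  by move=> pi rho /setIdP[pN _] /setIdP[rN _]; apply: krew_inj.
apply: subset_leq_card; apply/subsetP=> tau /setIdP[].
rewrite -{1}krew_image => /imsetP[pi pN ->]; rewrite below_krew // => sp.
by apply: imset_f; apply/setIdP.
Qed.

Definition discrete : {set {set 'I_n}} := [set [set i] | i : 'I_n].

Lemma same_block_discrete i j : same_block discrete i j = (i == j).
Proof.
apply/same_blockP/eqP => [[U /imsetP[x _ ->]]|<-].
  by rewrite !inE => /andP[/eqP-> /eqP->].
by exists [set i]; rewrite ?inE ?eqxx //; apply: imset_f.
Qed.

Lemma discrete_NC : discrete \in NC n.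
Proof.
have p : partition discrete setT.
  apply/and3P; split.
  - apply/eqP/setP=> i; rewrite inE; apply/bigcupP; exists [set i]; rewrite ?inE //.
    exact: imset_f.
  - apply/trivIsetP=> _ _ /imsetP[i _ ->] /imsetP[j _ ->].
    by rewrite disjoints1 inE (inj_eq set1_inj).
  - by apply/imsetP=> -[i _ /setP/(_ i)]; rewrite !inE eqxx.
rewrite inE p; apply/(NCVP p) => a b c d ab bc cd; rewrite !same_block_discrete.
by move=> /eqP ac; move: ab bc; rewrite ac; lia.
Qed.

Lemma same_block_full i j : same_block [set [set: 'I_n]] i j.
Proof. by apply/same_blockP; exists setT; rewrite ?inE. Qed.

Lemma full_NC : (0 < n)%N -> [set [set: 'I_n]] \in NC n.
Proof.
move=> n0; have p : partition [set [set: 'I_n]] setT.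
  apply/and3P; split.
  - by rewrite /cover big_set1.
  - by apply/trivIsetP=> A B; rewrite !inE => /eqP-> /eqP->; rewrite eqxx.
  - by rewrite inE; apply/eqP=> /setP/(_ (Ordinal n0)); rewrite !inE.
by rewrite inE p; apply/(NCVP p) => a b c d *; apply: same_block_full.
Qed.

Lemma krew_discrete : (0 < n)%N -> krew setT discrete = [set [set: 'I_n]].
Proof.
move=> n0; apply: NC_ext; rewrite ?krew_NC ?full_NC // => i j _.
rewrite same_block_krewT same_block_full; apply/saturatedP=> x y.
by rewrite same_block_discrete => /eqP->.
Qed.

Lemma krew_full : krew setT [set [set: 'I_n]] = discrete.
Proof.
apply: NC_ext; rewrite ?krew_NC ?discrete_NC // => i j ij.
rewrite same_block_krewT same_block_discrete -val_eqE /= ltn_eqF //.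
apply/negP=> /krelT_ltP-/(_ (ltnW ij))/(_ j i (same_block_full _ _)).
by rewrite ltnn ij leqnn => /(_ isT).
Qed.

Lemma krew_eq_full pi : (0 < n)%N -> pi \in NC n ->
  krew setT pi = [set [set: 'I_n]] -> pi = discrete.
Proof. by move=> n0 pN; rewrite -krew_discrete // => /krew_inj->; rewrite ?discrete_NC. Qed.

Lemma krew_eq_discrete pi : (0 < n)%N -> pi \in NC n ->
  krew setT pi = discrete -> pi = [set [set: 'I_n]].
Proof. by move=> n0 pN; rewrite -krew_full // => /krew_inj->; rewrite ?full_NC. Qed.

Lemma block_lt pi V : pi \in NC n -> pi != [set [set: 'I_n]] -> V \in pi -> (#|V| < n)%N.
Proof.
move=> pN pf Vp; rewrite -[X in (_ < X)%N]card_ord -cardsT.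
apply: proper_card; rewrite properT; apply: contraNneq pf => VT.
have /and3P[_ tI n0] := NC_partition pN.
apply/eqP/setP=> U; rewrite inE; apply/idP/eqP => [Up|->]; last by rewrite -VT.
have /set0Pn[i iU] : U != set0 by apply: contraNneq n0 => <-.
by rewrite -(def_pblock tI Up iU) -VT (def_pblock tI Vp) // VT inE.
Qed.

Lemma block_gt0 pi D V : partition pi D -> V \in pi -> (0 < #|V|)%N.
Proof. by case/and3P=> _ _ n0 Vp; rewrite card_gt0; apply: contraNneq n0 => <-. Qed.

End Bijection.

(** * Order embeddings and partitions of a subset *)

Section Transport.
Variables (m n : nat) (iota : 'I_m -> 'I_n).
Hypothesis iota_mono : forall i j, (iota i < iota j)%N = (i < j)%N.
Implicit Types (sigma tau : {set {set 'I_m}}).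

Let V : {set 'I_n} := [set iota i | i : 'I_m].

Lemma iota_inj : injective iota.
Proof.
move=> i j E; apply: val_inj; have := iota_mono i j; have := iota_mono j i.
by rewrite E ltnn /=; lia.
Qed.

Lemma iota_leq i j : (iota i <= iota j)%N = (i <= j)%N.
Proof. by rewrite [LHS]leqNgt [RHS]leqNgt iota_mono. Qed.

(** A subword w|V has positions of its own, ['I_m]; this carries its partitions to partitions of the
    image V among the positions of w. *)
Definition push sigma : {set {set 'I_n}} := [set [set iota i | i in U] | U : {set 'I_m} in sigma].

Lemma push_inj : injective push.
Proof. by apply: imset_inj; apply: imset_inj; apply: iota_inj. Qed.

Lemma same_block_push sigma i j :
  same_block (push sigma) (iota i) (iota j) = same_block sigma i j.
Proof.
apply/same_blockP/same_blockP => [[_ /imsetP[U Us ->]]|[U Us ij]].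
  by rewrite !mem_imset; [exists U|exact: iota_inj|exact: iota_inj].
by exists [set iota i | i in U]; [exact: imset_f|rewrite !mem_imset //; exact: iota_inj].
Qed.

Lemma push_partition sigma : partition sigma setT -> partition (push sigma) V.
Proof.
move=> /and3P[/eqP cs ts s0]; apply/and3P; split.
- apply/eqP/setP=> x; apply/bigcupP/imsetP => [[_ /imsetP[U Us ->] /imsetP[i iU ->]]|].
    by exists i.
  case=> i _ ->; have: i \in cover sigma by rewrite cs inE.
  case/bigcupP=> U Us iU; exists [set iota i | i in U]; exact: imset_f.
- apply/trivIsetP=> _ _ /imsetP[A As ->] /imsetP[B Bs ->] AB.
  apply/pred0Pn=> -[_ /andP[/imsetP[i iA ->]]]; rewrite /= mem_imset; last exact: iota_inj.
  move=> iB; case/eqP: AB; congr imset.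
  by rewrite -(def_pblock ts As iA) (def_pblock ts Bs iB).
- apply/imsetP=> -[U Us /esym/eqP]; rewrite -cards_eq0 card_imset; last exact: iota_inj.
  by rewrite cards_eq0 => /eqP U0; move: Us; rewrite U0 (negPf s0).
Qed.

Lemma push_NCV sigma : sigma \in NC m -> push sigma \in NCV V.
Proof.
move=> sN; have p := push_partition (NC_partition sN); rewrite inE p.
apply/(NCVP p) => a b c d ab bc cd ac bd.
have /andP[/imsetP[a' _ aE] /imsetP[c' _ cE]] := same_block_in p ac.
have /andP[/imsetP[b' _ bE] /imsetP[d' _ dE]] := same_block_in p bd.
move: ab bc cd ac bd; rewrite aE bE cE dE !iota_mono !same_block_push.
exact: NC_noncrossing.
Qed.

Lemma push_image : push @: NC m = NCV V.
Proof.
apply/setP=> tau; apply/imsetP/idP => [[sigma sN ->]|]; first exact: push_NCV.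
move=> tN; have := tN; rewrite inE => /andP[pt /(NCVP pt) nt].
have [_ tt _] := and3P pt; have iV i : iota i \in V by apply: imset_f.
case: (partition_equiv (T := 'I_m) (V := setT)
    (R := fun i j => same_block tau (iota i) (iota j))).
  move=> i j l _ _ _; rewrite (same_block_refl pt) //; split=> // ij.
  by apply/idP/idP; apply: same_block_trans => //; rewrite same_block_sym.
set sigma := equivalence_partition _ _ => ps sE.
have sN : sigma \in NC m.
  rewrite inE ps; apply/(NCVP ps) => a b c d ab bc cd; rewrite !sE !inE /=.
  by apply: nt; rewrite iota_mono; eassumption.
exists sigma => //; apply: (partition_ext pt (push_partition ps)).
by move=> _ _ /imsetP[i _ ->] /imsetP[j _ ->]; rewrite same_block_push sE !inE.
Qed.

(** The interval criterion relative to V depends only on the order of the points of V, which the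
    embedding preserves. *)
Lemma krew_push sigma : sigma \in NC m ->
  krew V (push sigma) = push (krew setT sigma).
Proof.
move=> sN; have p := push_partition (NC_partition sN).
apply: (partition_ext (krew_partition _ _)).
  exact/push_partition/krew_partition.
suff W (i j : 'I_m) : (i <= j)%N -> krel V (push sigma) (iota i) (iota j) = krel setT sigma i j.
  move=> _ _ /imsetP[i _ ->] /imsetP[j _ ->].
  rewrite same_block_push !same_block_krew !inE !imset_f //=.
  have [/W//|/ltnW/W] := leqP i j.
  by rewrite [krel V _ _ _]krelC [krel setT _ _ _]krelC.
move=> ij; have ij' : (iota i <= iota j)%N by rewrite iota_leq.
apply/(krel_ltP _ _ ij')/(krelT_ltP _ ij) => [H x y xy xij|H x0 y0 xy /imsetP[x _ xE] xij].
  have := H (iota x) (iota y); rewrite same_block_push xy imset_f // iota_mono iota_leq.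
  by rewrite xij iota_mono iota_leq imset_f //= => /(_ isT isT isT).
have /andP[_ /imsetP[y _ yE]] := same_block_in p xy; rewrite yE imset_f //=.
move: xy xij; rewrite xE yE same_block_push !iota_mono !iota_leq; exact: H.
Qed.

End Transport.

(** * Restriction to the blocks of a coarser partition, and gluing *)

Section Restrict.
Variable n : nat.
Implicit Types (i j x y : 'I_n) (sigma tau pi rho : {set {set 'I_n}}) (V U : {set 'I_n}).

Definition restrict sigma V : {set {set 'I_n}} := [set U in sigma | U \subset V].

Lemma prod_restrict (R : comPzRingType) pi sigma (a : {set 'I_n} -> R) :
  pi \in NC n -> sigma \in NC n -> below sigma pi ->
  (\prod_(U in sigma) a U = \prod_(V in pi) \prod_(U in restrict sigma V) a U)%R.
Proof.
move=> pN sN /belowP sp; have [/eqP cp tp _] := and3P (NC_partition pN).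
have [_ ts s0] := and3P (NC_partition sN).
transitivity (\prod_(U in sigma) \prod_(V in pi | U \subset V) a U)%R.
  apply: eq_bigr => U Us; have /set0Pn[i iU] : U != set0 by apply: contraNneq s0 => <-.
  have: i \in cover pi by rewrite cp inE.
  case/bigcupP=> V Vp iV.
  rewrite (big_pred1 V) // => W /=; apply/andP/eqP => [[Wp /subsetP/(_ i iU) iW]|->].
    by rewrite -(def_pblock tp Wp iW) (def_pblock tp Vp iV).
  split=> //; apply/subsetP=> j jU; rewrite -(same_blockE j tp Vp iV).
  by apply: sp; rewrite (same_blockE j ts Us iU).
rewrite (exchange_big_dep (fun V => V \in pi)) /=; last by move=> U V _ /andP[].
apply: eq_bigr => V Vp; apply: eq_bigl => U.
by rewrite in_set Vp.
Qed.

Lemma same_block_restrict pi sigma V i j : pi \in NC n -> partition sigma setT ->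
  below sigma pi -> V \in pi ->
  same_block (restrict sigma V) i j = (i \in V) && same_block sigma i j.
Proof.
move=> pN /and3P[_ ts _] /belowP sp Vp; have [_ tp _] := and3P (NC_partition pN).
apply/same_blockP/andP => [[U /setIdP[Us UV] /andP[iU jU]]|[iV /same_blockP[U Us /andP[iU jU]]]].
  by split; [exact: (subsetP UV)|apply/same_blockP; exists U; rewrite ?iU].
exists U; rewrite ?iU //; apply/setIdP; split=> //; apply/subsetP=> x xU.
rewrite -(same_blockE x tp Vp iV); apply: sp.
by apply/same_blockP; exists U; rewrite ?iU.
Qed.

Lemma restrict_partition pi sigma V : pi \in NC n -> partition sigma setT ->
  below sigma pi -> V \in pi -> partition (restrict sigma V) V.
Proof.
move=> pN ps sp Vp; have [/eqP cs ts s0] := and3P ps; apply/and3P; split.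
- apply/eqP/setP=> i; apply/bigcupP/idP => [[U /setIdP[_ /subsetP UV]]|iV]; first exact: UV.
  have : same_block (restrict sigma V) i i.
    by rewrite (same_block_restrict _ _ pN) // iV (same_block_refl ps) ?inE.
  by case/same_blockP=> U Us /andP[iU _]; exists U.
- by apply: trivIsetS ts; apply/subsetP=> U /setIdP[].
- by apply: contra s0 => /setIdP[].
Qed.

Lemma restrict_NCV pi sigma V : pi \in NC n -> sigma \in NC n ->
  below sigma pi -> V \in pi -> restrict sigma V \in NCV V.
Proof.
move=> pN sN sp Vp; have ps := NC_partition sN.
have p := restrict_partition pN ps sp Vp; rewrite inE p.
apply/(NCVP p) => a b c d ab bc cd.
rewrite !(same_block_restrict _ _ pN) // => /andP[-> ac] /andP[_ bd].
exact: NC_noncrossing ab bc cd ac bd.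
Qed.

(** For i and j in a block V of [pi], the interval condition tested on V alone already holds on all
    positions: the other points of ]i, j] lie in gaps of V together with their blocks of [sigma]. So
    the complement relative to V is K(sigma) cut down to V. *)
Lemma krew_restrict pi sigma V : pi \in NC n -> sigma \in NC n ->
  below sigma pi -> V \in pi ->
  krew V (restrict sigma V) = restrict (meet pi (krew setT sigma)) V.
Proof.
move=> pN sN sp Vp; have kN := krew_NC sigma; have mN := meet_NC pN kN.
have [_ tp _] := and3P (NC_partition pN).
have mp : below (meet pi (krew setT sigma)) pi by rewrite meetC; apply: meet_below.
apply: (partition_ext (krew_partition _ _)).
  by apply: restrict_partition Vp => //; apply: NC_partition.
suff W (i j : 'I_n) : i \in V -> j \in V -> (i <= j)%N ->
    krel V (restrict sigma V) i j = krel setT sigma i j.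
  move=> i j iV jV; rewrite same_block_krew iV jV.
  rewrite (same_block_restrict _ _ pN) ?NC_partition // iV same_block_meet //.
  rewrite (same_blockE _ tp Vp) // jV same_block_krewT /=.
  have [/W|/ltnW/W] := leqP i j; first exact.
  by rewrite [krel V _ _ _]krelC [krel setT _ _ _]krelC; apply.
move=> iV jV ij; apply/krel_ltP/idP => // H.
  apply: (krel_restrict pN sp) => //; first by rewrite (same_blockE _ tp Vp).
  move=> x y xy; rewrite (same_blockE _ tp Vp) // => xV xij.
  have := H x y; rewrite (same_block_restrict _ _ pN) ?NC_partition // xV.
  by case/(_ xy isT xij)/andP.
move=> x y; rewrite (same_block_restrict _ _ pN) ?NC_partition // => /andP[xV xy] _ xij.
have := belowP _ _ sp _ _ xy; rewrite (same_blockE _ tp Vp) // => ->.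
by move/krelT_ltP: H => /(_ ij x y xy xij).
Qed.

(** Expanding the product chooses a non-crossing partition in each block of [pi]; gluing these
    choices is inverse to restriction. The union is non-crossing because, [pi] being so, a crossing
    pattern lies in a single block of [pi], where the choice made there excludes it. *)
Lemma families_of_refinements (R : comPzRingType) pi
    (G : {set 'I_n} -> {set {set 'I_n}} -> R) : pi \in NC n ->
  (\prod_(V in pi) \sum_(tau in NCV V) G V tau =
   \sum_(sigma in NC n | below sigma pi) \prod_(V in pi) G V (restrict sigma V))%R.
Proof.
move=> pN; have [/eqP cp tp p0] := and3P (NC_partition pN).
rewrite (big_distr_big_dep set0).
(* Choice functions must take the default value [set0] outside [pi], as the expansion of the product
   requires. *)
pose split_ (sigma : {set {set 'I_n}}) : {ffun {set 'I_n} -> {set {set 'I_n}}} :=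
  [ffun V => if V \in pi then restrict sigma V else set0].
pose join (F : {ffun {set 'I_n} -> {set {set 'I_n}}}) := \bigcup_(V in pi) F V.
have joinP (F : {ffun {set 'I_n} -> {set {set 'I_n}}}) U :
    reflect (exists2 V, V \in pi & U \in F V) (U \in join F) by exact: bigcupP.
rewrite (reindex_onto split_ join) /=; last first.
  move=> F /pfamilyP[/supportP F0 FN]; apply/ffunP=> V; rewrite ffunE.
  have [Vp|/F0->//] := ifPn; apply/setP=> U; apply/setIdP/idP => [[/joinP[W Wp UW] UV]|UV].
    have := FN W Wp; rewrite inE => /andP[/and3P[/eqP cF _ n0] _].
    have /set0Pn[i iU] : U != set0 by apply: contraNneq n0 => <-.
    have iW : i \in W by rewrite -cF; apply/bigcupP; exists U.
    by rewrite -(def_pblock tp Vp (subsetP UV i iU)) (def_pblock tp Wp iW).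
  split; first by apply/joinP; exists V.
  have := FN V Vp; rewrite inE => /andP[/and3P[/eqP cF _ _] _].
  by rewrite -cF; apply: bigcup_sup UV.
have sF sigma V : V \in pi -> split_ sigma V = restrict sigma V by rewrite ffunE => ->.
apply: eq_big => [sigma|sigma _]; last by apply: eq_bigr => V Vp; rewrite sF.
apply/andP/andP => [[/pfamilyP[_ FN] /eqP jE]|[sN sp]]; last first.
  have [/eqP cs ts s0] := and3P (NC_partition sN); split.
    apply/pfamilyP; split; first by apply/supportP=> V Vp; rewrite ffunE (negPf Vp).
    by move=> V Vp; rewrite sF //; apply: restrict_NCV Vp.
  apply/eqP/setP=> U; apply/joinP/idP => [[V Vp]|Us]; first by rewrite sF // => /setIdP[].
  have /set0Pn[i iU] : U != set0 by apply: contraNneq s0 => <-.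
  have: i \in cover pi by rewrite cp inE.
  case/bigcupP=> V Vp iV; exists V; rewrite // sF //; apply/setIdP; split=> //.
  apply/subsetP=> j jU; rewrite -(same_blockE j tp Vp iV); apply: (belowP _ _ sp).
  by rewrite (same_blockE j ts Us iU).
have inV U : U \in sigma -> exists2 V, V \in pi & U \in restrict sigma V.
  by rewrite -{1}jE => /joinP[V Vp]; rewrite sF // => UV; exists V.
have rN V : V \in pi -> restrict sigma V \in NCV V by move=> Vp; rewrite -sF // FN.
have rp V : V \in pi -> partition (restrict sigma V) V by move/rN; rewrite inE => /andP[].
have sp : below sigma pi.
  apply/belowP=> i j /same_blockP[U /inV[V Vp /setIdP[_ /subsetP UV]] /andP[iU jU]].
  by rewrite (same_blockE _ tp Vp) UV.
have ps : partition sigma setT.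
  apply/and3P; split.
  - apply/eqP/setP=> i; rewrite inE; have: i \in cover pi by rewrite cp inE.
    case/bigcupP=> V Vp; have /and3P[/eqP<- _ _] := rp V Vp.
    by case/bigcupP=> U /setIdP[Us _] iU; apply/bigcupP; exists U.
  - apply/trivIsetP=> A B /inV[V Vp AV] /inV[W Wp BW] AB; apply/pred0Pn=> -[i /andP[/= iA iB]].
    have VW : V = W.
      have iV : i \in V by have /setIdP[_ /subsetP/(_ i iA)] := AV.
      have iW : i \in W by have /setIdP[_ /subsetP/(_ i iB)] := BW.
      by rewrite -(def_pblock tp Vp iV) (def_pblock tp Wp iW).
    have /and3P[_ tV _] := rp V Vp; rewrite -VW in BW.
    by case/eqP: AB; rewrite -(def_pblock tV AV iA) (def_pblock tV BW iB).
  - by apply/negP=> /inV[V /rp/and3P[_ _ /negP]].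
split=> //; rewrite inE ps; apply/(NCVP ps) => a b c d ab bc cd ac bd.
have spP := belowP _ _ sp.
have /same_blockP[V Vp /andP[aV bV]] := NC_noncrossing pN ab bc cd (spP _ _ ac) (spP _ _ bd).
have := rN V Vp; rewrite inE => /andP[_ /(NCVP (rp V Vp))/(_ a b c d ab bc cd)].
by rewrite !(same_block_restrict _ _ pN) // aV bV /=; apply.
Qed.

End Restrict.

(** * The group law *)

Lemma enum_ord_sorted n (A : {set 'I_n}) : sorted (fun i j : 'I_n => (i < j)%N) (enum A).
Proof.
rewrite /enum_mem -enumT; apply: sorted_filter; first by move=> i j l; apply: ltn_trans.
by have := iota_ltn_sorted 0 n; rewrite -val_enum_ord sorted_map.
Qed.

(** * Subwords of subwords *)

Section SubwordEmbedding.
Variables (T : Type) (w : seq T) (V : {set 'I_(size w)}).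

Definition subword_pos (i : 'I_(size (subword V))) : 'I_(size w) :=
  enum_val (cast_ord (size_subword V) i).

Lemma subword_pos_mono i j : (subword_pos i < subword_pos j)%N = (i < j)%N.
Proof.
suff W (a b : 'I_(size (subword V))) : (a < b)%N -> (subword_pos a < subword_pos b)%N.
  case: (ltngtP i j) => [/W//|/W/ltnW|/val_inj->]; last exact: ltnn.
  by rewrite leqNgt => /negbTE.
move=> ab; rewrite /subword_pos.
have x0 : 'I_(size w) := subword_pos a.
rewrite !(enum_val_nth x0) /=.
apply: (sorted_ltn_nth _ _ (enum_ord_sorted V)) => //.
- by move=> ? ? ?; apply: ltn_trans.
- by rewrite inE -cardE -(size_subword V).
- by rewrite inE -cardE -(size_subword V).
Qed.

Lemma subword_pos_image : [set subword_pos i | i : 'I_(size (subword V))] = V.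
Proof.
apply/setP=> x; apply/imsetP/idP => [[i _ ->]|xV]; first exact: enum_valP.
exists (cast_ord (esym (size_subword V)) (enum_rank_in xV x)) => //.
by rewrite /subword_pos cast_ordKV enum_rankK_in.
Qed.

(** The two position sets have different ordinal types, but the words agree as sequences: an
    increasing embedding maps the enumeration of U to that of its image. *)
Lemma subword_subword (U : {set 'I_(size (subword V))}) :
  subword U = subword [set subword_pos i | i in U].
Proof.
have inj := iota_inj subword_pos_mono.
have E : enum [set subword_pos i | i in U] = [seq subword_pos i | i <- enum U].
  apply: (irr_sorted_eq (leT := fun i j : 'I_(size w) => (i < j)%N)).
  - by move=> ? ? ?; apply: ltn_trans.
  - by move=> ?; apply: ltnn.
  - exact: enum_ord_sorted.
  - rewrite sorted_map; apply: sub_sorted (enum_ord_sorted U) => i j /=.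
    by rewrite subword_pos_mono.
  - move=> x; rewrite mem_enum; apply/imsetP/mapP => [[i iU ->]|[i]].
      by exists i; rewrite ?mem_enum.
    by rewrite mem_enum => iU ->; exists i.
rewrite /subword E -map_comp; apply: eq_map => i /=.
have x0 : T by case: (w) (subword_pos i) => [[]|x ? ?].
rewrite !(tnth_nth x0) /= (nth_map (subword_pos i)); last first.
  by rewrite -cardE -(size_subword V).
by rewrite (tnth_nth x0) [in RHS]/subword_pos (enum_val_nth (subword_pos i)).
Qed.

End SubwordEmbedding.

(** * Associativity and unit of the boxed convolution *)

Section BoxedMonoid.
Variables (s : nat) (D : pred nat) (k : fieldType) (R : comAlgType k).
Hypothesis D0 : ~~ D 0%N.
Hypothesis D_down : forall l m, D m -> (0 < l <= m)%N -> D l.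
Implicit Types (f g h : ncseries s D R) (w : seq 'I_s).

Lemma D_gt0 m : D m -> (0 < m)%N.
Proof. by case: m => //; rewrite (negPf D0). Qed.

Lemma D_block w pi A V : D (size w) -> partition pi A -> V \in pi ->
  D (size (@subword 'I_s w V)).
Proof.
move=> Dw p Vp; apply: D_down Dw _; rewrite size_subword (block_gt0 p) //=.
by rewrite -[X in (_ <= X)%N]card_ord max_card.
Qed.

Lemma coefE f w (Dw : D (size w)) : coef f w = f (Sub w Dw).
Proof. by rewrite /coef insubT. Qed.

Lemma coef_boxed f g w : D (size w) ->
  coef (boxed f g) w =
  \sum_(pi in NC (size w)) coef_part f pi * coef_part g (krew setT pi).
Proof.
move=> Dw; rewrite coefE /boxed /=; apply: eq_bigr => pi pN.
by rewrite kreweras_krew.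
Qed.

Lemma coef_part_push f w (V : {set 'I_(size w)}) sigma :
  coef_part f (push (@subword_pos 'I_s w V) sigma) = coef_part f sigma.
Proof.
have inj := iota_inj (@subword_pos_mono _ _ V).
rewrite /coef_part big_imset /=; last by move=> A B _ _; apply: imset_inj.
by apply: eq_bigr => U _; rewrite -subword_subword.
Qed.

Lemma coef_boxed_block f g w (V : {set 'I_(size w)}) : D (size (subword V)) ->
  coef (boxed f g) (subword V) =
  \sum_(tau in NCV V) coef_part f tau * coef_part g (krew V tau).
Proof.
move=> DV; rewrite coef_boxed //; have mono := @subword_pos_mono _ _ V.
have im := push_image mono; rewrite subword_pos_image in im.
rewrite -im big_imset /=; last by move=> A B _ _; apply: push_inj mono _ _.
apply: eq_bigr => sigma sN; have := krew_push mono sN; rewrite subword_pos_image => ->.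
by rewrite !coef_part_push.
Qed.

(** The sums over the non-crossing partitions of the blocks of [pi] merge into one sum over the
    refinements sigma of [pi], and the complements relative to the blocks merge into pi /\
    K(sigma). *)
Lemma coef_part_boxed f g w (pi : {set {set 'I_(size w)}}) : D (size w) ->
  pi \in NC (size w) ->
  coef_part (boxed f g) pi =
  \sum_(sigma in NC (size w) | below sigma pi)
     coef_part f sigma * coef_part g (meet pi (krew setT sigma)).
Proof.
move=> Dw pN; have pp := NC_partition pN.
transitivity (\prod_(V in pi) \sum_(tau in NCV V) coef_part f tau * coef_part g (krew V tau)).
  by apply: eq_bigr => V Vp; rewrite coef_boxed_block // (D_block Dw pp).
rewrite families_of_refinements //; apply: eq_bigr => sigma /andP[sN sp].
have kN := krew_NC sigma; rewrite big_split /=; congr (_ * _).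
  by rewrite [RHS](prod_restrict _ pN).
rewrite [RHS](prod_restrict _ pN) ?meet_NC //; last first.
  by rewrite meetC; apply: meet_below.
by apply: eq_bigr => V Vp; rewrite (krew_restrict pN sN sp Vp).
Qed.

Lemma boxedA : associative (@boxed s D k R).
Proof.
move=> f g h; apply/funext=> w; have Dw := valP w.
rewrite -!(coef_val _ w) !coef_boxed //; set n := size _.
transitivity (\sum_(sigma in NC n) \sum_(tau in NC n | below tau (krew setT sigma))
    coef_part f sigma * (coef_part g tau * coef_part h (meet (krew setT sigma) (krew setT tau)))).
  apply: eq_bigr => sigma sN; rewrite coef_part_boxed ?krew_NC //.
  by rewrite mulr_sumr.
(* Substitution tau = pi /\ K(sigma), with pi running over the partitions above sigma; then the two
   sums are exchanged. *)
transitivity (\sum_(sigma in NC n) \sum_(pi in NC n | below sigma pi)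
    coef_part f sigma * (coef_part g (meet pi (krew setT sigma)) * coef_part h (krew setT pi))).
  apply: eq_bigr => sigma sN; have [inj im] := meet_krew_image sN.
  rewrite -(eq_bigl _ _ (fun tau => in_set _ tau)) -im big_imset //=.
  rewrite (eq_bigl _ _ (fun pi => in_set _ pi)).
  by apply: eq_bigr => pi /andP[pN sp]; rewrite -krew_relative.
rewrite (exchange_big_dep (mem (NC n))) //=; last by move=> ? ? _ /andP[].
apply: eq_bigr => pi pN; rewrite coef_part_boxed // mulr_suml.
by apply: eq_big => [sigma|sigma _]; rewrite ?pN ?mulrA.
Qed.

Lemma coef_unit w : D (size w) ->
  coef (boxed_unit R : ncseries s D R) w = (size w == 1%N)%:R.
Proof. by move=> Dw; rewrite coefE. Qed.

Lemma coef_part_discrete f w :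
  coef_part f (discrete (size w)) = \prod_(i <- w) coef f [:: i].
Proof.
rewrite /coef_part big_imset /=; last by move=> i j _ _; apply: set1_inj.
rewrite -[in RHS](in_tupleE w) big_tuple.
by apply: eq_bigr => i _; rewrite /subword enum_set1.
Qed.

Lemma coef_part_full f w : coef_part f [set [set: 'I_(size w)]] = coef f w.
Proof.
rewrite /coef_part big_set1; congr coef; rewrite /subword enum_setT -enumT.
by have := map_tnth_enum (in_tuple w); rewrite enumT => /= ->.
Qed.

Lemma boxed_triangular f g w : D (size w) -> (1 < size w)%N ->
  coef (boxed f g) w =
  (\prod_(i <- w) coef f [:: i]) * coef g w +
  \sum_(pi in NC (size w) | pi != discrete (size w))
     coef_part f pi * coef_part g (krew setT pi).
Proof.
move=> Dw w1; rewrite coef_boxed // (bigD1 (discrete _)) ?discrete_NC //=.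
by rewrite krew_discrete ?(ltnW w1) // coef_part_discrete coef_part_full.
Qed.

Lemma coef_part_unit w (pi : {set {set 'I_(size w)}}) : D (size w) -> pi \in NC (size w) ->
  coef_part (boxed_unit R : ncseries s D R) pi = (pi == discrete (size w))%:R.
Proof.
move=> Dw pN; have pp := NC_partition pN; have [->|ne] := eqVneq.
  rewrite coef_part_discrete big1_seq // => i _; rewrite coef_unit //.
  by apply: (D_down Dw); rewrite /= (D_gt0 Dw).
have [V Vp V1] : exists2 V, V \in pi & #|V| != 1%N.
  apply: contrapT => H; case/eqP: ne; apply: (NC_ext pN (discrete_NC _)) => i j ij.
  rewrite same_block_discrete -val_eqE /= ltn_eqF //; apply/same_blockP=> -[U Up].
  have [/eqP/cards1P[x ->]|U1] := eqVneq #|U| 1%N; last by case: H; exists U.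
  rewrite !inE => /andP[/eqP xi /eqP xj].
  by move: ij; rewrite xi xj ltnn.
rewrite /coef_part (bigD1 V) //= coef_unit ?(D_block Dw pp) //.
by rewrite size_subword (negPf V1) mul0r.
Qed.

Lemma boxed1f : left_id (boxed_unit R) (@boxed s D k R).
Proof.
move=> f; apply/funext=> w; have Dw := valP w; have w0 := D_gt0 Dw.
rewrite -!(coef_val _ w) coef_boxed // (bigD1 (discrete _)) ?discrete_NC //=.
rewrite big1 ?addr0 => [|pi /andP[pN ne]].
  by rewrite coef_part_unit ?discrete_NC // eqxx mul1r krew_discrete // coef_part_full.
by rewrite coef_part_unit // (negPf ne) mul0r.
Qed.

Lemma boxedf1 : right_id (boxed_unit R) (@boxed s D k R).
Proof.
move=> f; apply/funext=> w; have Dw := valP w; have w0 := D_gt0 Dw.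
rewrite -!(coef_val _ w) coef_boxed // (bigD1 [set setT]) ?full_NC //=.
rewrite big1 ?addr0 => [|pi /andP[pN ne]].
  by rewrite krew_full coef_part_unit ?discrete_NC // eqxx mulr1 coef_part_full.
rewrite coef_part_unit ?krew_NC //; case: eqP => [/(krew_eq_discrete w0 pN)/eqP|_].
  by rewrite (negPf ne).
by rewrite mulr0.
Qed.

End BoxedMonoid.

Lemma letter_cond_inverse plus (k : fieldType) (R : comAlgType k) (x : R) :
  letter_cond plus x -> exists y, x * y = 1.
Proof. by rewrite /letter_cond; case: plus => // ->; exists 1; rewrite mulr1. Qed.

Lemma letter_cond_symmetric plus (k : fieldType) (R : comAlgType k) (x y : R) :
  letter_cond plus x -> x * y = 1 -> letter_cond plus y.
Proof.
by case: plus => [/= ->|_ xy]; [rewrite mul1r|exists x; rewrite mulrC].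
Qed.

(** * Inverses and the group functor *)

Section SeriesGroup.
Variables (k : fieldType) (s : nat) (plus : bool) (D : pred nat).
Hypothesis D0 : ~~ D 0%N.
Hypothesis D1 : D 1%N.
Hypothesis D_down : forall l m, D m -> (0 < l <= m)%N -> D l.

Section RightInverse.
Variables (R : comAlgType k) (f : ncseries s D R) (y : 'I_s -> R).
Hypothesis fy : forall i, coef f [:: i] * y i = 1.

(** The triangular equation for a right inverse of [f], solved for X_w(g) in terms of shorter words
    of [g]. A right inverse is a fixed point, and iteration stands in for a recursion on the length
    of w. *)
Definition inverse_step (g : ncseries s D R) : ncseries s D R := fun w =>
  (\prod_(i <- val w) y i) *
  (if size (val w) == 1%N then 1 else
   - \sum_(pi in NC (size (val w)) | pi != discrete (size (val w)))
        coef_part f pi * coef_part g (krew setT pi)).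

Definition agree_below m (g h : ncseries s D R) :=
  forall w : word s D, (size (val w) < m)%N -> g w = h w.

Lemma inverse_step_agree m g h : agree_below m g h ->
  agree_below m.+1 (inverse_step g) (inverse_step h).
Proof.
move=> gh w wm; rewrite /inverse_step; congr (_ * _); case: eqP => // w1.
have Dw := valP w; congr (- _); apply: eq_bigr => pi /andP[pN pd]; congr (_ * _).
have kN := krew_NC pi; apply: eq_bigr => V Vk.
have DV : D (size (subword V)) := D_block D_down Dw (NC_partition kN) Vk.
rewrite !(coefE _ DV); apply: gh => /=; rewrite size_subword.
apply: leq_trans (_ : size (val w) <= m)%N => //.
apply: (block_lt kN) Vk; apply: contraNneq pd => /krew_eq_full-> //.
exact: (D_gt0 D0 Dw).
Qed.

Lemma inverse_step_iter m p g : (m <= p)%N ->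
  agree_below m (iter m inverse_step g) (iter p inverse_step g).
Proof.
elim: m p => [|m IHm] [|p] // mp; apply: inverse_step_agree; exact: IHm.
Qed.

(** Each iteration settles one more length, so |w| + 1 of them settle the value at w; the starting
    series does not influence it. *)
Definition right_inverse_series : ncseries s D R :=
  fun w => iter (size (val w)).+1 inverse_step (fun=> 0) w.

Lemma right_inverse_fix : inverse_step right_inverse_series = right_inverse_series.
Proof.
apply/funext=> w; rewrite [RHS]/right_inverse_series iterS.
apply: (inverse_step_agree (m := size (val w))) => // v vw.
by apply: (@inverse_step_iter (size (val v)).+1).
Qed.

Lemma coef_right_inverse_letter i : coef right_inverse_series [:: i] = y i.
Proof.
rewrite (coefE (D := D) _ (D1 : D (size [:: i]))) -right_inverse_fix.
by rewrite /inverse_step /= big_seq1 mulr1.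
Qed.

Lemma boxed_right_inverse : boxed f right_inverse_series = boxed_unit R.
Proof.
apply/funext=> w; have Dw := valP w; rewrite -!(coef_val _ w).
have prod1 (u : seq 'I_s) : (\prod_(i <- u) coef f [:: i]) * (\prod_(i <- u) y i) = 1.
  by rewrite -big_split /= big1.
have [w1|w1] := eqVneq (size (val w)) 1%N.
  rewrite coef_unit // w1 eqxx coef_val boxed_letter // -!(coef_val _ w).
  case: (val w) w1 => [|i []] // _; by rewrite coef_right_inverse_letter fy.
rewrite boxed_triangular //; last by move: (D_gt0 D0 Dw) w1; case: size => [|[]].
rewrite coef_unit // (negPf w1) -{1}right_inverse_fix coef_val /inverse_step (negPf w1).
by rewrite mulrA prod1 mul1r addNr.
Qed.

End RightInverse.

Lemma gseries_letter (R : comAlgType k) (f : gseries s plus D R) i :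
  letter_cond plus (coef (sval f) [:: i]).
Proof. by rewrite (coefE (D := D) _ (D1 : D (size [:: i]))); apply: (svalP f). Qed.

Lemma gseries_right_inverse (R : comAlgType k) (f : gseries s plus D R) :
  exists g, gseries_mul f g = gseries_one s plus D R.
Proof.
have /choice[y fy] : forall i, exists y, coef (sval f) [:: i] * y = 1.
  by move=> i; apply/letter_cond_inverse/gseries_letter.
have gP (w : word s D) : size (val w) = 1%N ->
    letter_cond plus (right_inverse_series (sval f) y w).
  move=> w1; rewrite -(coef_val _ w); case: (val w) w1 => [|i []] // _.
  rewrite coef_right_inverse_letter.
  exact: (letter_cond_symmetric (gseries_letter f i) (fy i)).
by exists (exist _ _ gP); apply: gseries_eq => w /=; rewrite boxed_right_inverse.
Qed.

Lemma gseries_group_axioms (R : comAlgType k) :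
  group_axioms (gseries_group k s plus D) R.
Proof.
have A : associative (@gseries_mul k s plus D R).
  by move=> f g h; apply: gseries_eq => w /=; rewrite boxedA.
have L : left_id (gseries_one s plus D R) (@gseries_mul k s plus D R).
  by move=> f; apply: gseries_eq => w /=; rewrite boxed1f.
have Ri : right_id (gseries_one s plus D R) (@gseries_mul k s plus D R).
  by move=> f; apply: gseries_eq => w /=; rewrite boxedf1.
split=> //= f; have [g fg] := gseries_right_inverse f.
have [h gh] := gseries_right_inverse g; exists g; split=> //.
(* Right inverses suffice in a monoid: f = f (g h) = (f g) h = h. *)
suff -> : f = h by [].
by rewrite -[LHS]Ri -gh A fg L.
Qed.

Lemma coef_map (R R' : comAlgType k) (phi : {lrmorphism R -> R'})
    (f : gseries s plus D R) w :
  coef (sval (gseries_map phi f)) w = phi (coef (sval f) w).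
Proof. by rewrite /coef; case: insubP => //= _; rewrite rmorph0. Qed.

Lemma coef_part_map (R R' : comAlgType k) (phi : {lrmorphism R -> R'})
    (f : gseries s plus D R) (w : seq 'I_s) (pi : {set {set 'I_(size w)}}) :
  coef_part (sval (gseries_map phi f)) pi = phi (coef_part (sval f) pi).
Proof. by rewrite rmorph_prod; apply: eq_bigr => V _; rewrite coef_map. Qed.

Lemma gseries_group_functor : group_functor (gseries_group k s plus D).
Proof.
split=> [||*|R R' phi f g].
- exact: gseries_group_axioms.
- by move=> R x; apply: gseries_eq.
- exact: gseries_eq.
- apply: gseries_eq => w /=; rewrite rmorph_sum; apply: eq_bigr => pi _.
  by rewrite rmorphM; congr (_ * _); rewrite -[LHS]coef_part_map.
Qed.

End SeriesGroup.

(** * The full groups as limits of their truncations *)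

Section InverseLimit.
Variables (k : fieldType) (s : nat) (plus : bool).

Lemma tower_inverse_limit :
  inverse_limit (S := tower k s plus) (G := gseries_group k s plus positive_lengths)
    (@tower_proj k s plus).
Proof.
split=> [i|i j ij R x|R y yP].
- exact: truncate_hom.
- apply: gseries_eq => w; apply: coef_truncate.
  exact: (@lengths_upto_leq i.+1 j.+1 ij _ (valP w)).
have lt0 (w : word s positive_lengths) : lengths_upto (size (val w)).-1.+1 (size (val w)).
  by have := valP w; case: size => // n _; rewrite /lengths_upto /= leqnn.
(* Stage i keeps the lengths up to i + 1, so |w| - 1 is the first stage that sees w; by
   compatibility all later stages agree with it. *)
pose x (w : word s positive_lengths) : R := coef (sval (y (size (val w)).-1)) (val w).
have xP w : size (val w) = 1%N -> letter_cond plus (x w).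
  by move=> w1; rewrite /x (coefE _ (lt0 w)); apply: (svalP (y _)).
have coef_y i (w : seq 'I_s) : lengths_upto i.+1 (size w) ->
    coef (sval (y i)) w = coef (sval (y (size w).-1)) w.
  move=> wi; have le : ((size w).-1 <= i)%N by move: wi => /andP[]; case: size.
  rewrite -(yP _ _ le) coef_truncate //.
  by move: wi => /andP[]; case: size => // n _ _; rewrite /lengths_upto /= leqnn.
exists (exist _ x xP : gseries s plus positive_lengths R); split=> [i|z zP].
  apply: gseries_eq => w /=; rewrite -[RHS](coef_val _ w) coef_y; last exact: (valP w).
  by rewrite (coefE _ (lengths_upto_positive (valP w))).
apply: gseries_eq => w /=; rewrite /x -zP coef_truncate ?coef_val //.
Qed.

End InverseLimit.

(** * Monoid algebras *)

Section PresentedMonoid.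
Variables (G : choiceType) (rel : seq G -> Prop).

(** A relator is a word set equal to the identity of the free commutative monoid; the quotient is
    written additively. *)
Inductive mon_eq : seq G -> seq G -> Prop :=
| MonRefl s : mon_eq s s
| MonSym s t : mon_eq s t -> mon_eq t s
| MonTrans s t u : mon_eq s t -> mon_eq t u -> mon_eq s u
| MonCat s s' t t' : mon_eq s s' -> mon_eq t t' -> mon_eq (s ++ t) (s' ++ t')
| MonComm s t : mon_eq (s ++ t) (t ++ s)
| MonRel s : rel s -> mon_eq s [::].

Definition mon_eqb (s t : seq G) : bool := `[< mon_eq s t >].

Lemma mon_eqb_refl : reflexive mon_eqb.
Proof. by move=> s; apply/asboolP; apply: MonRefl. Qed.

Lemma mon_eqb_sym : symmetric mon_eqb.
Proof. by move=> s t; apply/asboolP/asboolP; apply: MonSym. Qed.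

Lemma mon_eqb_trans : transitive mon_eqb.
Proof.
by move=> t s u /asboolP st /asboolP tu; apply/asboolP; apply: MonTrans st tu.
Qed.

Canonical mon_equiv := EquivRel mon_eqb mon_eqb_refl mon_eqb_sym mon_eqb_trans.

Definition presented_monoid : Type := {eq_quot mon_equiv}.
HB.instance Definition _ := EqQuotient.on presented_monoid.
HB.instance Definition _ := Choice.on presented_monoid.

Definition mon_class (s : seq G) : presented_monoid := \pi_presented_monoid s.

Lemma mon_classP s t : mon_class s = mon_class t <-> mon_eq s t.
Proof.
split=> [/eqP|st]; last by apply/eqP; rewrite eqmodE; apply/asboolP.
by rewrite eqmodE => /asboolP.
Qed.

Lemma mon_class_repr x : mon_class (repr x) = x.
Proof. exact: reprK. Qed.

Lemma mon_class_ind (P : presented_monoid -> Prop) :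
  (forall s, P (mon_class s)) -> forall x, P x.
Proof. by move=> PP x; rewrite -(mon_class_repr x). Qed.

Lemma repr_mon_class s : mon_eq (repr (mon_class s)) s.
Proof. by apply/mon_classP; rewrite mon_class_repr. Qed.

Definition mon_add (x y : presented_monoid) := mon_class (repr x ++ repr y).

Lemma mon_addE s t : mon_add (mon_class s) (mon_class t) = mon_class (s ++ t).
Proof. by apply/mon_classP; apply: MonCat; apply: repr_mon_class. Qed.

Lemma mon_addA : associative mon_add.
Proof.
elim/mon_class_ind=> x; elim/mon_class_ind=> y; elim/mon_class_ind=> z.
by rewrite !mon_addE catA.
Qed.

Lemma mon_addC : commutative mon_add.
Proof.
elim/mon_class_ind=> x; elim/mon_class_ind=> y; rewrite !mon_addE.
by apply/mon_classP; apply: MonComm.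
Qed.

Lemma mon_add0 : left_id (mon_class [::]) mon_add.
Proof. by elim/mon_class_ind=> x; rewrite mon_addE. Qed.

HB.instance Definition _ :=
  GRing.isNmodule.Build presented_monoid mon_addA mon_addC mon_add0.

Definition mon_gen (g : G) : presented_monoid := mon_class [:: g].

Lemma mon_class_sum s : mon_class s = \sum_(g <- s) mon_gen g.
Proof.
elim: s => [|g s IHs]; first by rewrite big_nil.
by rewrite big_cons -IHs [RHS]mon_addE.
Qed.

Lemma mon_rel s : rel s -> \sum_(g <- s) mon_gen g = 0.
Proof. by move=> rs; rewrite -mon_class_sum; apply/mon_classP; apply: MonRel. Qed.

Lemma mon_ind (P : presented_monoid -> Prop) :
  P 0 -> (forall g x, P x -> P (mon_gen g + x)) -> forall x, P x.
Proof.
move=> P0 Pg; elim/mon_class_ind=> s; rewrite mon_class_sum.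
by elim: s => [|g s IHs]; rewrite ?big_nil ?big_cons //; apply: Pg.
Qed.

Section Lift.
Variables (N : Type) (idx : N) (op : Monoid.com_law idx) (F : G -> N).
Hypothesis F_rel : forall s, rel s -> \big[op/idx]_(g <- s) F g = idx.

(** The universal property for an arbitrary commutative law: it gives the degree ([addn]), the map
    chi (addition in the monoid itself) and the points of the group over R (multiplication in R). *)
Definition mon_lift (x : presented_monoid) : N := \big[op/idx]_(g <- repr x) F g.

Lemma mon_liftE s : mon_lift (mon_class s) = \big[op/idx]_(g <- s) F g.
Proof.
suff H t u : mon_eq t u ->
    \big[op/idx]_(g <- t) F g = \big[op/idx]_(g <- u) F g.
  exact/H/repr_mon_class.
elim=> {t u} //.
- by move=> t u v _ -> _ ->.
- by move=> t t' u u' _ tt' _ uu'; rewrite !big_cat /= tt' uu'.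
- by move=> t u; rewrite !big_cat /= Monoid.mulmC.
- by move=> t /F_rel->; rewrite big_nil.
Qed.

Lemma mon_lift0 : mon_lift 0 = idx.
Proof. by rewrite mon_liftE big_nil. Qed.

Lemma mon_lift_gen g : mon_lift (mon_gen g) = F g.
Proof. by rewrite mon_liftE big_seq1. Qed.

Lemma mon_liftD x y : mon_lift (x + y) = op (mon_lift x) (mon_lift y).
Proof.
elim/mon_class_ind: x => s; elim/mon_class_ind: y => t.
by rewrite [_ + _]mon_addE !mon_liftE big_cat.
Qed.

End Lift.

End PresentedMonoid.

Section MonoidAlgebra.
Variables (k : fieldType) (M : nmodType).

Definition formal_coef (s : seq (k * M)) (m : M) : k :=
  \sum_(p <- s) p.1 * (p.2 == m)%:R.

Lemma formal_sum_collect (V : lmodType k) (F : M -> V) s (ms : seq M) :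
  uniq ms -> {subset map snd s <= ms} ->
  \sum_(p <- s) p.1 *: F p.2 = \sum_(m <- ms) formal_coef s m *: F m.
Proof.
move=> ums; elim: s => [|[c a] s IHs] sub.
  by rewrite big_nil big1 // => m _; rewrite /formal_coef big_nil scale0r.
rewrite big_cons IHs => [|m ms_m]; last by apply: sub; rewrite inE ms_m orbT.
under [RHS]eq_bigr => m _ do rewrite /formal_coef big_cons scalerDl.
rewrite big_split /=; congr (_ + _).
rewrite (bigD1_seq a) //=; last by apply: sub; rewrite inE eqxx.
rewrite eqxx mulr1 big1 ?addr0 // => m ma.
by rewrite eq_sym (negPf ma) mulr0 scale0r.
Qed.

Lemma formal_sum_ext (V : lmodType k) (F : M -> V) s t :
  formal_coef s =1 formal_coef t ->
  \sum_(p <- s) p.1 *: F p.2 = \sum_(p <- t) p.1 *: F p.2.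
Proof.
move=> st; pose ms := undup (map snd (s ++ t)).
have sub u : {subset u <= s ++ t} -> {subset map snd u <= ms}.
  move=> us m /mapP[p /us pst ->]; rewrite mem_undup; exact: map_f.
rewrite !(@formal_sum_collect _ _ _ ms) ?undup_uniq //.
- by apply: eq_bigr => m _; rewrite st.
- by apply: sub => p pt; rewrite mem_cat pt orbT.
- by apply: sub => p pt; rewrite mem_cat pt.
Qed.

(** Elements are coefficient functions arising from some finite formal sum: equality is pointwise,
    and a formal sum is recovered by choice as [mrepr]. *)
Record monoid_algebra : Type := MonoidAlgebra {
  mcoef : M -> k;
  mcoef_formal : exists s, mcoef = formal_coef s
}.

HB.instance Definition _ := gen_eqMixin monoid_algebra.
HB.instance Definition _ := gen_choiceMixin monoid_algebra.

Implicit Types (x y z : monoid_algebra).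

Lemma mcoef_inj x y : mcoef x =1 mcoef y -> x = y.
Proof.
case: x y => x xP [y yP] /= /funext E; rewrite E in xP *.
by congr MonoidAlgebra; apply: Prop_irrelevance.
Qed.

Definition formal (s : seq (k * M)) : monoid_algebra :=
  MonoidAlgebra (ex_intro _ s erefl).

Definition mrepr x : seq (k * M) := projT1 (cid (mcoef_formal x)).

Lemma mcoef_mrepr x : mcoef x = formal_coef (mrepr x).
Proof. exact: (projT2 (cid (mcoef_formal x))). Qed.

Definition malg_zero := formal [::].
Definition malg_opp x := formal [seq (- p.1, p.2) | p <- mrepr x].
Definition malg_add x y := formal (mrepr x ++ mrepr y).
Definition malg_scale c x := formal [seq (c * p.1, p.2) | p <- mrepr x].

Lemma mcoef_zero m : mcoef malg_zero m = 0.
Proof. by rewrite /= /formal_coef big_nil. Qed.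

Lemma mcoef_opp x m : mcoef (malg_opp x) m = - mcoef x m.
Proof.
rewrite (mcoef_mrepr x) /= /formal_coef big_map -sumrN.
by apply: eq_bigr => p _; rewrite mulNr.
Qed.

Lemma mcoef_add x y m : mcoef (malg_add x y) m = mcoef x m + mcoef y m.
Proof. by rewrite (mcoef_mrepr x) (mcoef_mrepr y) /= /formal_coef big_cat. Qed.

Lemma mcoef_scale c x m : mcoef (malg_scale c x) m = c * mcoef x m.
Proof.
rewrite (mcoef_mrepr x) /= /formal_coef big_map mulr_sumr.
by apply: eq_bigr => p _; rewrite mulrA.
Qed.

Let mcoefE := (mcoef_zero, mcoef_opp, mcoef_add, mcoef_scale).

Lemma malg_addA : associative malg_add.
Proof. by move=> x y z; apply: mcoef_inj => m; rewrite !mcoefE addrA. Qed.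

Lemma malg_addC : commutative malg_add.
Proof. by move=> x y; apply: mcoef_inj => m; rewrite !mcoefE addrC. Qed.

Lemma malg_add0 : left_id malg_zero malg_add.
Proof. by move=> x; apply: mcoef_inj => m; rewrite !mcoefE add0r. Qed.

Lemma malg_addN : left_inverse malg_zero malg_opp malg_add.
Proof. by move=> x; apply: mcoef_inj => m; rewrite !mcoefE addNr. Qed.

HB.instance Definition _ :=
  GRing.isZmodule.Build monoid_algebra malg_addA malg_addC malg_add0 malg_addN.

Lemma malg_scaleA a b x : malg_scale a (malg_scale b x) = malg_scale (a * b) x.
Proof. by apply: mcoef_inj => m; rewrite !mcoefE mulrA. Qed.

Lemma malg_scale1 : left_id 1 malg_scale.
Proof. by move=> x; apply: mcoef_inj => m; rewrite !mcoefE mul1r. Qed.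

Lemma malg_scaleDr : right_distributive malg_scale +%R.
Proof. by move=> a x y; apply: mcoef_inj => m; rewrite !mcoefE mulrDr. Qed.

Lemma malg_scaleDl x : {morph malg_scale^~ x : a b / a + b}.
Proof. by move=> a b; apply: mcoef_inj => m; rewrite !mcoefE mulrDl. Qed.

HB.instance Definition _ := GRing.Zmodule_isLmodule.Build k monoid_algebra
  malg_scaleA malg_scale1 malg_scaleDr malg_scaleDl.

Definition monomial (m : M) : monoid_algebra := formal [:: (1, m)].

Lemma mcoef_monomial a m : mcoef (monomial a) m = (a == m)%:R.
Proof. by rewrite /= /formal_coef big_seq1 mul1r. Qed.

Lemma mcoefD x y m : mcoef (x + y) m = mcoef x m + mcoef y m.
Proof. exact: mcoef_add. Qed.

Lemma mcoefZ c x m : mcoef (c *: x) m = c * mcoef x m.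
Proof. exact: mcoef_scale. Qed.

Lemma mcoef0 m : mcoef 0 m = 0.
Proof. exact: mcoef_zero. Qed.

(** Linear extension from the basis of monomials; [formal_sum_ext] makes it independent of the
    chosen formal sum. *)
Definition extend (V : lmodType k) (F : M -> V) x : V :=
  \sum_(p <- mrepr x) p.1 *: F p.2.

Lemma extend_formal (V : lmodType k) (F : M -> V) s :
  extend F (formal s) = \sum_(p <- s) p.1 *: F p.2.
Proof. by apply: formal_sum_ext => m; rewrite -mcoef_mrepr. Qed.

Lemma extend_monomial (V : lmodType k) (F : M -> V) m : extend F (monomial m) = F m.
Proof. by rewrite extend_formal big_seq1 scale1r. Qed.

Lemma extend_linear (V : lmodType k) (F : M -> V) : linear (extend F).
Proof.
move=> c x y; have -> : c *: x + y =
    formal ([seq (c * p.1, p.2) | p <- mrepr x] ++ mrepr y).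
  apply: mcoef_inj => m; rewrite mcoefD mcoefZ (mcoef_mrepr x) (mcoef_mrepr y) /=.
  rewrite /formal_coef big_cat big_map mulr_sumr /=; congr (_ + _).
  by apply: eq_bigr => p _; rewrite mulrA.
rewrite extend_formal big_cat big_map /=; congr (_ + _).
by rewrite /extend scaler_sumr; apply: eq_bigr => p _; rewrite scalerA.
Qed.

Lemma extendP (V : lmodType k) (F : M -> V) c x y :
  extend F (c *: x + y) = c *: extend F x + extend F y.
Proof. exact: extend_linear. Qed.

Lemma malg_ind (P : monoid_algebra -> Prop) :
  P 0 -> (forall c m x, P x -> P (c *: monomial m + x)) -> forall x, P x.
Proof.
move=> P0 Pm x; have -> : x = formal (mrepr x) by apply: mcoef_inj => m; rewrite mcoef_mrepr.
elim: (mrepr x) => [//|[c m] s IHs].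
have -> : formal ((c, m) :: s) = c *: monomial m + formal s; last exact: Pm.
apply: mcoef_inj => a; rewrite mcoefD mcoefZ mcoef_monomial.
by rewrite /= {1}/formal_coef big_cons.
Qed.

Definition malg_mul x y := extend (fun a => extend (fun b => monomial (a + b)) y) x.

Lemma malg_mul_linl y : linear (malg_mul^~ y).
Proof. exact: extend_linear. Qed.

Lemma malg_mul_linr x : linear (malg_mul x).
Proof.
move=> c y z; rewrite /malg_mul {1 3 5}/extend scaler_sumr -big_split /=.
apply: eq_bigr => p _; rewrite extendP scalerDr !scalerA.
by rewrite [p.1 * c]mulrC.
Qed.

Lemma malg_mul_monomial a b : malg_mul (monomial a) (monomial b) = monomial (a + b).
Proof. by rewrite /malg_mul !extend_monomial. Qed.

Lemma linear_at0 (V W : lmodType k) (F : V -> W) : linear F -> F 0 = 0.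
Proof. by move=> /(_ (-1) 0 0); rewrite scaler0 addr0 scaleN1r addNr. Qed.

Lemma linear_eq (V : lmodType k) (F F' : monoid_algebra -> V) :
  linear F -> linear F' -> (forall m, F (monomial m) = F' (monomial m)) -> F =1 F'.
Proof.
move=> lF lF' E; elim/malg_ind => [|c m x IHx]; first by rewrite !linear_at0.
by rewrite lF lF' E IHx.
Qed.

Lemma malg_mulC : commutative malg_mul.
Proof.
move=> x y; move: x; apply: linear_eq; [exact: malg_mul_linl|exact: malg_mul_linr|].
move=> a; move: y; apply: linear_eq; [exact: malg_mul_linr|exact: malg_mul_linl|].
by move=> b; rewrite !malg_mul_monomial addrC.
Qed.

Lemma malg_mulA : associative malg_mul.
Proof.
move=> x y z; move: x; apply: linear_eq; first exact: malg_mul_linl.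
  by move=> c u v; rewrite !malg_mul_linl.
move=> a; move: y; apply: linear_eq.
- by move=> c u v; rewrite malg_mul_linl malg_mul_linr.
- by move=> c u v; rewrite malg_mul_linr malg_mul_linl.
move=> b; move: z; apply: linear_eq.
- by move=> c u v; rewrite !malg_mul_linr.
- exact: malg_mul_linr.
by move=> c; rewrite !malg_mul_monomial addrA.
Qed.

Lemma malg_mul1 : left_id (monomial 0) malg_mul.
Proof.
apply: linear_eq; [exact: malg_mul_linr|by []|].
by move=> b; rewrite malg_mul_monomial add0r.
Qed.

Lemma malg_mulDl : left_distributive malg_mul +%R.
Proof. by move=> x y z; have := malg_mul_linl z 1 x y; rewrite !scale1r. Qed.

Lemma malg_1_neq0 : monomial 0 != 0.
Proof.
apply/eqP=> /(congr1 (fun x => mcoef x 0))/eqP.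
by rewrite mcoef_monomial eqxx mcoef0 oner_eq0.
Qed.

HB.instance Definition _ := GRing.Zmodule_isComNzRing.Build monoid_algebra
  malg_mulA malg_mulC malg_mul1 malg_mulDl malg_1_neq0.

Lemma malg_scalerAl c x y : c *: (x * y) = (c *: x) * y.
Proof.
have z : malg_mul 0 y = 0 := linear_at0 (malg_mul_linl y).
have E : malg_mul (c *: x + 0) y = c *: malg_mul x y + malg_mul 0 y.
  exact: malg_mul_linl.
by move: E; rewrite z !addr0 => <-.
Qed.

HB.instance Definition _ := GRing.Lmodule_isLalgebra.Build k monoid_algebra malg_scalerAl.
HB.instance Definition _ := GRing.Lalgebra_isComAlgebra.Build k monoid_algebra.

Lemma monomial0 : monomial 0 = 1.
Proof. by []. Qed.

Lemma monomialD a b : monomial (a + b) = monomial a * monomial b.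
Proof. by rewrite [RHS]malg_mul_monomial. Qed.

Lemma monomial_lift (R : comAlgType k) (h : M -> R) :
  h 0 = 1 -> (forall a b, h (a + b) = h a * h b) ->
  exists phi : {lrmorphism monoid_algebra -> R}, forall m, phi (monomial m) = h m.
Proof.
move=> h0 hD; pose f := extend h.
have fL : linear f := extend_linear h.
have fM : GRing.monoid_morphism f.
  split=> [|x y]; first by rewrite -monomial0 /f extend_monomial.
  have lL (u : monoid_algebra) : linear (fun x => f (x * u)).
    by move=> c a b; rewrite mulrDl -scalerAl fL.
  have lR (u : monoid_algebra) : linear (fun x => f (u * x)).
    by move=> c a b; rewrite mulrDr -scalerAr fL.
  move: x; apply: linear_eq => [||a]; [exact: lL| |].
    by move=> c a b; rewrite fL mulrDl -scalerAl.
  move: y; apply: linear_eq => [||b]; [exact: lR| |].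
    by move=> c b b'; rewrite fL mulrDr -scalerAr.
  by rewrite -monomialD /f !extend_monomial hD.
pose fl := GRing.isLinear.Build k monoid_algebra R *:%R f fL.
pose fm := GRing.isMonoidMorphism.Build monoid_algebra R f fM.
pose phi : {lrmorphism monoid_algebra -> R} := HB.pack f fl fm.
by exists phi => m; rewrite /= /f extend_monomial.
Qed.

Lemma lrmorphism_eq (R : comAlgType k) (phi psi : {lrmorphism monoid_algebra -> R}) :
  (forall m, phi (monomial m) = psi (monomial m)) -> phi =1 psi.
Proof. by move=> E; apply: linear_eq => //; apply: linearP. Qed.

End MonoidAlgebra.

(** * Coordinate rings *)

Lemma letter_cond_plus (plus : bool) (k : fieldType) (R : comAlgType k) (x : R) :
  plus -> letter_cond plus x -> x = 1.
Proof. by case: plus. Qed.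

Section CoordinateRing.
Variables (k : fieldType) (s : nat) (plus : bool) (D : pred nat).

Let G : choiceType := ({w : seq 'I_s | D (size w)} * bool)%type.

(* (w, true) stands for X_w and, for a letter w, (w, false) for its inverse.   *)
Definition coordinate_rel (l : seq G) : Prop := exists w : word s D,
  [\/ [/\ plus, size (val w) = 1%N & l = [:: (w, true)]],
      size (val w) = 1%N /\ l = [:: (w, true); (w, false)]
    | size (val w) != 1%N /\ l = [:: (w, false)]].

Let M := presented_monoid coordinate_rel.

Definition coordinate_algebra : comAlgType k := monoid_algebra k M.
Local Notation B := coordinate_algebra.

Definition gen (w : word s D) (b : bool) : M := mon_gen coordinate_rel ((w, b) : G).

Lemma gen_plus w : plus -> size (val w) = 1%N -> gen w true = 0.
Proof.
move=> p w1; rewrite -[LHS](big_seq1 +%R ((w, true) : G) (mon_gen coordinate_rel)).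
by apply: mon_rel; exists w; constructor 1.
Qed.

Lemma gen_inv w : size (val w) = 1%N -> gen w true + gen w false = 0.
Proof.
move=> w1; have <- : \sum_(g <- [:: (w, true); (w, false)] : seq G) mon_gen coordinate_rel g =
   gen w true + gen w false by rewrite big_cons big_seq1.
by apply: mon_rel; exists w; constructor 2.
Qed.

Lemma gen_long w : size (val w) != 1%N -> gen w false = 0.
Proof.
move=> w1; rewrite -[LHS](big_seq1 +%R ((w, false) : G) (mon_gen coordinate_rel)).
by apply: mon_rel; exists w; constructor 3.
Qed.

Lemma universal_subproof (w : word s D) :
  size (val w) = 1%N -> letter_cond plus (monomial k (gen w true) : B).
Proof.
move=> w1; rewrite /letter_cond; case: ifP => p; first by rewrite gen_plus.
by exists (monomial k (gen w false)); rewrite -monomialD gen_inv.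
Qed.

Definition universal_series : gseries_group k s plus D B :=
  exist _ _ universal_subproof.

(** A point over R amounts to a multiplicative map from the monoid to R: its values on the X_w are
    the coefficients, and uniqueness of inverses forces the rest. *)
Lemma coordinate_ring_universal : coordinate_ring universal_series.
Proof.
move=> R x; split; last first.
  move=> phi psi phiE psiE; apply: lrmorphism_eq.
  have E w : phi (monomial k (gen w true)) = psi (monomial k (gen w true)).
    have := congr1 (fun f => sval f w) phiE; have := congr1 (fun f => sval f w) psiE.
    by move=> /= -> ->.
  have E' w : phi (monomial k (gen w false)) = psi (monomial k (gen w false)).
    have [w1|w1] := eqVneq (size (val w)) 1%N; last first.
      by rewrite gen_long // monomial0 !rmorph1.
    have I (chi : {lrmorphism B -> R}) :
        chi (monomial k (gen w true)) * chi (monomial k (gen w false)) = 1.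
      by rewrite -rmorphM -monomialD gen_inv // monomial0 rmorph1.
    by rewrite -[LHS]mul1r -(I psi) -E mulrAC I mul1r.
  elim/mon_ind=> [|[w b] m IHm]; first by rewrite monomial0 !rmorph1.
  rewrite monomialD !rmorphM; congr (_ * _); last exact: IHm.
  by case: b; [apply: E|apply: E'].
(* The value of the generator (w, false): an inverse of the coefficient if w is a letter, and 1 for
   any other w, where that generator is trivial. *)
have /choice[y xy] : forall w : word s D, exists y : R,
    (size (val w) = 1%N -> sval x w * y = 1) /\ (size (val w) != 1%N -> y = 1).
  move=> w; have [w1|w1] := eqVneq (size (val w)) 1%N; last first.
    by exists 1; split=> // w1'; rewrite w1' in w1.
  by have [y xy] := letter_cond_inverse (svalP x w w1); exists y; split=> // /negP[]; apply/eqP.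
pose F (g : G) : R := if g.2 then sval x g.1 else y g.1.
have F_rel l : coordinate_rel l -> \big[*%R/1]_(g <- l) F g = 1.
  case=> w [[p w1 ->]|[w1 ->]|[w1 ->]]; rewrite ?big_cons big_nil ?mulr1 /F /=.
  - exact: (letter_cond_plus p (svalP x w w1)).
  - by rewrite (proj1 (xy w)).
  - by rewrite (proj2 (xy w)).
have [|a b|phi phiE] := @monomial_lift k M R (mon_lift *%R F).
- exact: mon_lift0.
- exact: mon_liftD.
exists phi; apply: gseries_eq => w /=; rewrite phiE.
by rewrite mon_lift_gen.
Qed.

Lemma coordinate_algebra_fg (ws : seq {w : seq 'I_s | D (size w)}) :
  (forall w, w \in ws) -> finitely_generated B.
Proof.
move=> wsP; exists [seq monomial k (gen w b) | w <- ws, b <- [:: true; false]].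
move=> S [S1 SL SM] gS.
have gw w b : monomial k (gen w b) \in S.
  by apply/gS/allpairsP; exists (w, b); split => //; case: (b); rewrite ?inE.
have S0 : 0 \in S by have := SL (-1) 1 1 S1 S1; rewrite scaleN1r addNr.
elim/malg_ind=> [//|c m x xS]; apply: SL => //.
elim/mon_ind: m => [//|[w b] m mS]; rewrite monomialD; apply: SM => //; exact: gw.
Qed.

End CoordinateRing.

Lemma words_upto_finite s n : exists ws : seq {w : seq 'I_s | lengths_upto n (size w)},
  forall w, w \in ws.
Proof.
pose all_words := flatten [seq [seq tval t | t <- enum {: m.-tuple 'I_s}] | m <- iota 0 n.+1].
exists (pmap insub all_words) => w; rewrite mem_pmap_sub.
have /andP[_ wn] := valP w; apply/flatten_mapP; exists (size (val w)).
  by rewrite mem_iota.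
by apply/mapP; exists (in_tuple (val w)); rewrite ?mem_enum.
Qed.

Section Schemes.
Variables (k : fieldType) (s : nat) (plus : bool).

Lemma gseries_affine D : ~~ D 0%N -> D 1%N ->
  (forall l m, D m -> (0 < l <= m)%N -> D l) ->
  affine_group_scheme (gseries_group k s plus D).
Proof.
move=> D0 D1 Dd; split; first exact: gseries_group_functor.
by exists _, (universal_series k s plus D); apply: coordinate_ring_universal.
Qed.

Lemma lengths_upto_down n l m : lengths_upto n m -> (0 < l <= m)%N -> lengths_upto n l.
Proof. by rewrite /lengths_upto /= => /andP[_ mn] /andP[-> lm]; apply: leq_trans mn. Qed.

Lemma positive_lengths_down l m : positive_lengths m -> (0 < l <= m)%N -> positive_lengths l.
Proof. by move=> _ /andP[]. Qed.

Lemma gseries_upto_algebraic n : (1 <= n)%N ->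
  algebraic_group (gseries_group k s plus (lengths_upto n)).
Proof.
move=> n1; split; first by apply: gseries_affine => //; exact: lengths_upto_down.
exists _, (universal_series k s plus (lengths_upto n)); split.
  exact: coordinate_ring_universal.
have [ws wsP] := words_upto_finite s n; exact: coordinate_algebra_fg wsP.
Qed.

End Schemes.

(** * Comodules *)

Section Tensor.
Variables (k : fieldType) (V : lmodType k) (R : comAlgType k).
Implicit Types (v : V) (r : R) (x : tensor V R).

Lemma tensDl v v' r : tens (v + v') r = tens v r + tens v' r.
Proof. by rewrite [RHS]tens_addE; apply/tclassP; apply: TensAddl. Qed.

Lemma tensDr v r r' : tens v (r + r') = tens v r + tens v r'.
Proof. by rewrite [RHS]tens_addE; apply/tclassP; apply: TensAddr. Qed.

Lemma tensZ c v r : tens v (c *: r) = tens (c *: v) r.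
Proof. by apply/tclassP; apply: TensSym; apply: TensScale. Qed.

Lemma tens0l r : tens (0 : V) r = 0.
Proof. by apply/tclassP; apply: TensZero. Qed.

Lemma tens0r v : tens v (0 : R) = 0.
Proof. by rewrite -[0 in LHS](scale0r (0 : R)) tensZ scale0r tens0l. Qed.

Lemma tens_scale_tens r r' v : r *: tens v r' = tens v (r * r').
Proof. by rewrite [LHS]tens_scaleE. Qed.

Lemma tclass_sum (l : seq (V * R)) : tclass l = \sum_(p <- l) tens p.1 p.2.
Proof.
elim: l => [|[v r] l IHl]; first by rewrite big_nil.
by rewrite big_cons -IHl [RHS]tens_addE.
Qed.

Lemma tens_suml (I : Type) (l : seq I) (F : I -> V) r :
  tens (\sum_(i <- l) F i) r = \sum_(i <- l) tens (F i) r.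
Proof. by elim/big_rec2: _ => [|i y x _ <-]; rewrite ?tens0l ?tensDl. Qed.

End Tensor.

Section TensorMap.
Variables (k : fieldType) (V : lmodType k) (R R' : comAlgType k).
Variable phi : {lrmorphism R -> R'}.

Lemma tens_map_tens (v : V) r : tens_map phi (tens v r) = tens v (phi r).
Proof. exact: tens_mapE. Qed.

Lemma tens_mapD (x y : tensor V R) : tens_map phi (x + y) = tens_map phi x + tens_map phi y.
Proof.
elim/tens_ind: x => a; elim/tens_ind: y => b.
by rewrite [_ + _]tens_addE !tens_mapE map_cat [RHS]tens_addE.
Qed.

Lemma tens_map_sum (I : Type) (l : seq I) (F : I -> tensor V R) :
  tens_map phi (\sum_(i <- l) F i) = \sum_(i <- l) tens_map phi (F i).
Proof.
elim/big_rec2: _ => [|i y x _ <-]; last exact: tens_mapD.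
exact: (tens_mapE phi [::]).
Qed.

End TensorMap.

(** * Coefficients of tensors over a monoid algebra *)

Section Contraction.
Variables (k : fieldType) (V : lmodType k) (M : nmodType).
Local Notation A := (monoid_algebra k M).

Definition contract (m : M) (x : tensor V A) : V :=
  \sum_(p <- repr x) mcoef p.2 m *: p.1.

Lemma contractE m l : contract m (tclass l) = \sum_(p <- l) mcoef p.2 m *: p.1.
Proof.
suff H (a b : seq (V * A)) : tens_eq a b ->
    \sum_(p <- a) mcoef p.2 m *: p.1 = \sum_(p <- b) mcoef p.2 m *: p.1.
  exact/H/repr_tclass.
elim=> {a b} [//|//|a b c _ -> _ -> //|a a' b b' _ ab _ ab'|a b|r|v v' r|v r r'|c v r].
- by rewrite !big_cat ab ab'.
- by rewrite !big_cat /= addrC.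
- by rewrite big_seq1 big_nil scaler0.
- by rewrite !big_cons !big_nil !addr0 scalerDr.
- by rewrite !big_cons !big_nil !addr0 mcoefD scalerDl.
- by rewrite !big_seq1 mcoefZ scalerA [c * _]mulrC.
Qed.

Lemma contract_tens m v r : contract m (tens v r) = mcoef r m *: v.
Proof. by rewrite contractE big_seq1. Qed.

Lemma contractD m x y : contract m (x + y) = contract m x + contract m y.
Proof.
elim/tens_ind: x => a; elim/tens_ind: y => b.
by rewrite [_ + _]tens_addE !contractE big_cat.
Qed.

Lemma contract0 m : contract m 0 = 0.
Proof. by rewrite contractE big_nil. Qed.

Lemma contract_sum m (I : Type) (l : seq I) (F : I -> tensor V A) :
  contract m (\sum_(i <- l) F i) = \sum_(i <- l) contract m (F i).
Proof. by elim/big_rec2: _ => [|i y x _ <-]; rewrite ?contract0 ?contractD. Qed.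

(** Scalars are moved to the left factor and equal monomials are collected. The finite support
    obtained here is what later makes a monomial of highest degree available. *)
Lemma tensor_expand (x : tensor V A) : exists ms : seq M,
  [/\ uniq ms, forall m, m \notin ms -> contract m x = 0
    & x = \sum_(m <- ms) tens (contract m x) (monomial k m)].
Proof.
have [l ->] : exists l : seq (V * M), x = \sum_(p <- l) tens p.1 (monomial k p.2).
  elim/tens_ind: x => a; elim: a => [|[v r] a [l IHl]].
    by exists [::]; rewrite big_nil.
  rewrite tclass_sum big_cons -tclass_sum IHl /=.
  elim/malg_ind: r => [|c m r [l' IHr]]; first by exists l; rewrite tens0r add0r.
  exists ((c *: v, m) :: l'); rewrite big_cons -IHr addrA; congr (_ + _).
  by rewrite tensDr tensZ.
pose ms := undup (map snd l); exists ms.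
have E m : contract m (\sum_(p <- l) tens p.1 (monomial k p.2)) =
    \sum_(p <- l) (p.2 == m)%:R *: p.1.
  by rewrite contract_sum; apply: eq_bigr => p _; rewrite contract_tens mcoef_monomial.
split; first exact: undup_uniq.
  move=> m; rewrite mem_undup E => mN; rewrite big1_seq // => p /andP[_ pl].
  rewrite (_ : p.2 == m = false) ?scale0r //; apply: contraNF mN => /eqP<-.
  exact: map_f.
transitivity (\sum_(m <- ms) \sum_(p <- l) tens ((p.2 == m)%:R *: p.1) (monomial k m)).
  rewrite exchange_big /=; apply: eq_big_seq => p pl.
  rewrite (bigD1_seq p.2) ?undup_uniq ?mem_undup ?map_f //= eqxx scale1r.
  rewrite big1 ?addr0 // => m pm.
  by rewrite eq_sym (negPf pm) scale0r tens0l.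
by apply: eq_bigr => m _; rewrite E tens_suml.
Qed.

Lemma contract_inj (x y : tensor V A) : (forall m, contract m x = contract m y) -> x = y.
Proof.
move=> E; apply/eqP; rewrite -subr_eq0; apply/eqP.
have [ms [_ _ ->]] := tensor_expand (x - y); rewrite big1 // => m _.
have : contract m (x - y) + contract m y = contract m x by rewrite -contractD subrK.
by rewrite E -[RHS]add0r => /addIr->; rewrite tens0l.
Qed.

End Contraction.

Lemma max_degree (T : eqType) (deg : T -> nat) (l : seq T) (a : T) : a \in l ->
  exists2 m, m \in l & forall m', m' \in l -> (deg m' <= deg m)%N.
Proof.
elim: l a => // b l IHl a _; case: (l) IHl => [|c l'] IHl.
  by exists b; rewrite ?inE // => m'; rewrite inE => /eqP->.
have [|m ml mmax] := IHl c; first by rewrite inE eqxx.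
have [le|/ltnW le] := leqP (deg b) (deg m).
  exists m => [|m']; first by rewrite inE ml orbT.
  by rewrite inE => /orP[/eqP->|/mmax].
exists b => [|m']; first by rewrite inE eqxx.
by rewrite inE => /orP[/eqP->|/mmax/leq_trans->].
Qed.

(** * Eigenvectors from a triangular comultiplication *)

Section Eigenvector.
Variables (k : fieldType) (G : group_data k) (M : nmodType).
Local Notation A := (monoid_algebra k M).
Local Notation A2 := (monoid_algebra k (M * M)%type).
Variables (u : G A) (i1 i2 Delta : {lrmorphism A -> A2}).
Variables (deg : M -> nat) (chi : M -> M).
Hypothesis i1E : forall m, i1 (monomial k m) = monomial k (m, 0).
Hypothesis i2E : forall m, i2 (monomial k m) = monomial k (0, m).
Hypothesis Delta_mul : gmap G Delta u = gmul G (gmap G i1 u) (gmap G i2 u).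
Hypothesis u_inv : exists y : G A, gmul G y u = gone G A.
(** Monomials of degree above that of m0 may contribute anything at (m', m0); choosing m0 of highest
    degree keeps them out. *)
Hypothesis DeltaE : forall m m' m0, (deg m <= deg m0)%N ->
  mcoef (Delta (monomial k m)) (m', m0) = ((m == m0) && (m' == chi m0))%:R.
Variables (V : lmodType k) (X : representation G V).

Lemma rep_act_gmap_tens (R : comAlgType k) (phi : {lrmorphism A -> R}) (v : V) :
  rep_act X (gmap G phi u) (tens v 1) = tens_map phi (rep_act X u (tens v 1)).
Proof. by rewrite rep_act_natural tens_map_tens rmorph1. Qed.

Lemma rep_act_sum (R : comAlgType k) (g : G R) (I : Type) (l : seq I)
    (a : I -> R) (x : I -> tensor V R) :
  rep_act X g (\sum_(i <- l) a i *: x i) = \sum_(i <- l) a i *: rep_act X g (x i).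
Proof.
elim: l => [|i l IHl]; last by rewrite !big_cons rep_act_linear IHl.
rewrite !big_nil; have := rep_act_linear X g (-1) 0 0.
by rewrite scaler0 addr0 scaleN1r addNr.
Qed.

Lemma mcoef_i1 m b m' m0 :
  mcoef (monomial k (0, m) * i1 b) (m', m0) = (m == m0)%:R * mcoef b m'.
Proof.
elim/malg_ind: b => [|c a b IHb]; first by rewrite rmorph0 mulr0 !mcoef0 mulr0.
have -> : i1 (c *: monomial k a + b) = c *: i1 (monomial k a) + i1 b by exact: linearP.
rewrite mulrDr -scalerAr mcoefD mcoefZ {}IHb mcoefD mcoefZ mulrDr; congr (_ + _).
rewrite i1E -monomialD !mcoef_monomial mulrCA; congr (_ * _).
rewrite -natrM mulnb; congr (_ %:R); congr nat_of_bool.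
by rewrite xpair_eqE /= addr0 add0r andbC.
Qed.

Lemma contract_i1 m (y : tensor V A) m' m0 :
  contract (m', m0) (monomial k (0, m) *: tens_map i1 y) = (m == m0)%:R *: contract m' y.
Proof.
elim/tens_ind: y => l; rewrite tens_mapE [_ *: _]tens_scaleE !contractE -map_comp big_map.
by rewrite scaler_sumr; apply: eq_bigr => p _; rewrite /= mcoef_i1 scalerA.
Qed.

(** Compare coefficients at (m', m0) in the action of Delta(u) = i1(u) i2(u) on v (x) 1. On the
    product side, i2(u) produces the v_m (x) (0, m) and i1(u) then acts on each v_m, which leaves
    the coefficient at m' of the coaction of v_m0. On the side of Delta only m = m0 survives. *)
Lemma eigenvector : (exists v : V, v != 0) ->
  exists2 v : V, v != 0 &
  exists m, rep_act X u (tens v 1) = tens v (monomial k (chi m)).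
Proof.
case=> v v0; set x := rep_act X u (tens v 1).
have [ms [ums msN xE]] := tensor_expand x.
(* The universal point is invertible, so its action is injective. *)
have x0 : x != 0.
  apply: contraNneq v0 => x0; have [y yu] := u_inv.
  have : tens v (1 : A) = 0.
    rewrite -[LHS](rep_act1 X) -yu rep_actM -/x x0.
    have := rep_act_linear X y (-1) 0 0.
    by rewrite scaler0 addr0 scaleN1r addNr.
  move=> /(congr1 (contract 0)); rewrite contract_tens contract0.
  by rewrite -monomial0 mcoef_monomial eqxx scale1r => ->.
pose supp := [seq m <- ms | contract m x != 0].
have [a asupp] : exists a, a \in supp.
  apply: contrapT => H; case/eqP: x0; rewrite xE big1_seq // => m /andP[_ mms].
  have [->|mx] := eqVneq (contract m x) 0; first exact: tens0l.
  by case: H; exists m; rewrite mem_filter mx.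
have [m0 + m0max] := max_degree deg asupp; rewrite mem_filter => /andP[vm0 m0ms].
exists (contract m0 x) => //; exists m0; apply: contract_inj => m'.
have lhs : contract (m', m0) (rep_act X (gmul G (gmap G i1 u) (gmap G i2 u)) (tens v 1)) =
    contract m' (rep_act X u (tens (contract m0 x) 1)).
  rewrite rep_actM rep_act_gmap_tens -/x xE tens_map_sum.
  under eq_bigr => m _ do rewrite tens_map_tens i2E -[monomial _ _]mulr1 -tens_scale_tens.
  rewrite rep_act_sum contract_sum (bigD1_seq m0) //= big1 ?addr0; last first.
    by move=> m mm0; rewrite rep_act_gmap_tens contract_i1 (negPf mm0) scale0r.
  by rewrite rep_act_gmap_tens contract_i1 eqxx scale1r -xE.
rewrite -lhs -Delta_mul rep_act_gmap_tens -/x {1}xE tens_map_sum contract_sum.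
rewrite contract_tens mcoef_monomial (bigD1_seq m0) //= big1 ?addr0; last first.
  move=> m mm0; rewrite tens_map_tens contract_tens.
  have [->|mx] := eqVneq (contract m x) 0; first by rewrite scaler0.
  rewrite DeltaE ?(negPf mm0) ?scale0r //; apply: m0max; rewrite mem_filter mx.
  by apply: contraNT mx => /msN->.
by rewrite tens_map_tens contract_tens DeltaE // eqxx eq_sym.
Qed.

End Eigenvector.

Lemma sum_card_pred n (pi : {set {set 'I_n}}) : partition pi setT ->
  (\sum_(V in pi) #|V|.-1 + #|pi|)%N = n.
Proof.
move=> pp; rewrite -sum1_card -big_split /= -[RHS]card_ord -cardsT (card_partition pp).
by apply: eq_bigr => V Vp; rewrite addn1 prednK // (block_gt0 pp).
Qed.

(** A partition with b blocks contributes degree n - b, so only the one-block partition reaches n -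
    1, the degree of X_w itself. *)
Lemma sum_card_pred_lt n (pi : {set {set 'I_n}}) : (0 < n)%N -> pi \in NC n ->
  pi != [set [set: 'I_n]] -> (\sum_(V in pi) #|V|.-1 < n.-1)%N.
Proof.
move=> n0 pN pf; have pp := NC_partition pN; have := sum_card_pred pp.
case E: #|pi| => [|[|m]]; last lia.
- move/eqP: E; rewrite cards_eq0 => /eqP pi0; have /and3P[/eqP + _ _] := pp.
  by rewrite pi0 /cover big_set0 => /setP/(_ (Ordinal n0)); rewrite !inE.
- move/eqP/cards1P: E => [W piW]; have /and3P[/eqP cT _ _] := pp.
  by case/eqP: pf; move: cT; rewrite piW /cover big_set1 => ->.
Qed.

(** * Triangularity of the comultiplication of the coordinate ring *)

Section Triangular.
Variables (k : fieldType) (s : nat) (plus : bool) (D : pred nat).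
Hypothesis D0 : ~~ D 0%N.
Hypothesis D1 : D 1%N.
Hypothesis D_down : forall l m, D m -> (0 < l <= m)%N -> D l.

Local Notation M := (presented_monoid (@coordinate_rel s plus D)).
Local Notation B := (monoid_algebra k M).
Local Notation B2 := (monoid_algebra k (M * M)%type).
Local Notation u := (universal_series k s plus D).
Local Notation gen := (@gen s plus D).

Definition letter (i : 'I_s) : word s D := exist _ [:: i] D1.

Lemma letterP (w : word s D) : size (val w) = 1%N -> exists i, w = letter i.
Proof.
case E: (val w) => [|i []] // _; exists i; exact: val_inj.
Qed.

(** Letters are invertible in the monoid, so an additive degree with values in [nat] must vanish on
    them; hence |w| - 1 rather than |w|. *)
Definition deg_gen (g : {w : seq 'I_s | D (size w)} * bool) : nat :=
  if g.2 then (size (val g.1)).-1 else 0%N.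

Definition deg : M -> nat := mon_lift addn deg_gen.

Lemma deg_rel l : coordinate_rel plus l -> (\sum_(g <- l) deg_gen g)%N = 0%N.
Proof.
by case=> w [[_ w1 ->]|[w1 ->]|[w1 ->]]; rewrite ?big_cons big_nil /deg_gen /= ?w1.
Qed.

Lemma deg0 : deg 0 = 0%N. Proof. exact: (mon_lift0 deg_rel). Qed.
Lemma degD a b : deg (a + b) = (deg a + deg b)%N. Proof. exact: (mon_liftD deg_rel). Qed.
Lemma deg_genE w b : deg (gen w b) = deg_gen (w, b).
Proof. exact: (mon_lift_gen deg_rel). Qed.

(** As chi fixes the letters it has to fix their inverses; for the other words the generator (w,
    false) is trivial anyway. *)
Definition chi_gen (g : {w : seq 'I_s | D (size w)} * bool) : M :=
  if g.2 then \sum_(i <- val g.1) gen (letter i) true else gen g.1 false.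

Definition chi : M -> M := mon_lift +%R chi_gen.

Lemma chi_gen_letter w : size (val w) = 1%N -> chi_gen (w, true) = gen w true.
Proof. by move=> /letterP[i ->]; rewrite /chi_gen /= big_seq1. Qed.

Lemma chi_rel l : coordinate_rel plus l -> \sum_(g <- l) chi_gen g = 0.
Proof.
case=> w [[p w1 ->]|[w1 ->]|[w1 ->]]; rewrite ?big_cons big_nil ?addr0.
- by rewrite chi_gen_letter // gen_plus.
- by rewrite chi_gen_letter // gen_inv.
- exact: gen_long.
Qed.

Lemma chi0 : chi 0 = 0. Proof. exact: (mon_lift0 chi_rel). Qed.
Lemma chiD a b : chi (a + b) = chi a + chi b. Proof. exact: (mon_liftD chi_rel). Qed.
Lemma chi_genE w b : chi (gen w b) = chi_gen (w, b).
Proof. exact: (mon_lift_gen chi_rel). Qed.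

Lemma chi_plus m : plus -> chi m = 0.
Proof.
move=> p; elim/mon_ind: m => [|[w b] m IHm]; first exact: chi0.
rewrite chiD IHm addr0 chi_genE; case: b.
  by rewrite /chi_gen /= big1_seq // => i _; apply: gen_plus.
have [w1|] := eqVneq (size (val w)) 1%N; last exact: gen_long.
by have := gen_inv plus w1; rewrite gen_plus // add0r.
Qed.

(** The span of the monomials (a, b) with deg b < d. Only the second factor is graded, as it is the
    one in which leading terms are compared. *)
Inductive low (d : nat) : B2 -> Prop :=
| Low0 : low d 0
| LowD x y : low d x -> low d y -> low d (x + y)
| LowZ c a b : (deg b < d)%N -> low d (c *: monomial k (a, b)).

Lemma low_mcoef d y a b : low d y -> (d <= deg b)%N -> mcoef y (a, b) = 0.
Proof.
elim=> [|x z _ IHx _ IHz|c a' b' lt] db; first exact: mcoef0.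
  by rewrite mcoefD IHx ?IHz ?addr0.
rewrite mcoefZ mcoef_monomial xpair_eqE.
have [E|_] := eqVneq b' b; last by rewrite andbF mulr0.
by rewrite E in lt; move: (leq_trans lt db); rewrite ltnn.
Qed.

Lemma low_monomial_mul d a b y : low d y -> low (deg b + d) (monomial k (a, b) * y).
Proof.
elim=> [|x z _ IHx _ IHz|c a' b' lt]; first by rewrite mulr0; apply: Low0.
  by rewrite mulrDr; apply: LowD.
by rewrite -scalerAr -monomialD; apply: LowZ; rewrite degD ltn_add2l.
Qed.

Lemma low_mul d d' x y : low d x -> low d' y -> low (d + d') (x * y).
Proof.
move=> lx ly; elim: lx => [|x1 x2 _ IH1 _ IH2|c a b lt].
- by rewrite mul0r; apply: Low0.
- by rewrite mulrDl; apply: LowD.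
rewrite -scalerAl; elim: ly => [|y1 y2 _ IH1 _ IH2|c' a' b' lt'].
- by rewrite mulr0 scaler0; apply: Low0.
- by rewrite mulrDr scalerDr; apply: LowD.
rewrite -scalerAr -monomialD scalerA; apply: LowZ; rewrite degD.
by rewrite -addSn leq_add // ltnW.
Qed.

Definition triangular (m : M) (x : B2) : Prop :=
  exists2 y, low (deg m) y & x = monomial k (chi m, m) + y.

Lemma triangular0 : triangular 0 1.
Proof. by exists 0; [apply: Low0|rewrite addr0 chi0]. Qed.

Lemma triangularM m m' x x' : triangular m x -> triangular m' x' ->
  triangular (m + m') (x * x').
Proof.
move=> [y ly ->] [y' ly' ->]; exists (monomial k (chi m, m) * y' +
    (y * monomial k (chi m', m') + y * y')).
  rewrite degD; apply: LowD; first exact: low_monomial_mul.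
  apply: LowD; last exact: low_mul.
  by rewrite mulrC addnC; apply: low_monomial_mul.
rewrite chiD -[(_ + _, _)]/((chi m, m) + (chi m', m')) monomialD.
by rewrite mulrDr !mulrDl !addrA; congr (_ + _); rewrite addrAC.
Qed.

(** Nothing lies below degree 0. For letters this says that the comultiplication is group-like. *)
Lemma triangular_deg0 m x : deg m = 0%N -> triangular m x -> x = monomial k (chi m, m).
Proof.
move=> m0 [y ly ->]; suff -> : y = 0 by rewrite addr0.
by apply: mcoef_inj => -[a b]; rewrite mcoef0 (low_mcoef a ly) // m0.
Qed.

Lemma coef_universal (w : seq 'I_s) (Dw : D (size w)) :
  coef (sval u) w = monomial k (gen (exist _ w Dw) true).
Proof. by rewrite (coefE (D := D) _ Dw). Qed.

Lemma coef_part_universal (w : seq 'I_s) (pi : {set {set 'I_(size w)}}) :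
  D (size w) -> pi \in NC (size w) ->
  exists2 b, coef_part (sval u) pi = monomial k b & deg b = (\sum_(V in pi) #|V|.-1)%N.
Proof.
move=> Dw pN; have pp := NC_partition pN; rewrite /coef_part.
elim/big_ind2: _ => [|x d y e [a -> <-] [b -> <-]|V Vp].
- by exists 0; rewrite ?monomial0 ?deg0.
- by exists (a + b); rewrite ?monomialD ?degD.
have DV := D_block D_down Dw pp Vp; rewrite (coef_universal DV).
by eexists; first reflexivity; rewrite deg_genE /deg_gen /= size_subword.
Qed.

Lemma coef_letters_universal (w : seq 'I_s) :
  \prod_(i <- w) coef (sval u) [:: i] = monomial k (\sum_(i <- w) gen (letter i) true).
Proof.
rewrite (big_morph _ (@monomialD k M) (monomial0 k M)).
by apply: eq_bigr => i _; rewrite (coef_universal (D1 : D (size [:: i]))).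
Qed.

Section Comultiplication.
Variables (i1 i2 Delta : {lrmorphism B -> B2}).
Hypothesis i1E : forall m, i1 (monomial k m) = monomial k (m, 0).
Hypothesis i2E : forall m, i2 (monomial k m) = monomial k (0, m).
Hypothesis Delta_mul : gseries_map Delta u =
  gseries_mul (gseries_map i1 u) (gseries_map i2 u).

Lemma Delta_gen_true (w : word s D) :
  triangular (gen w true) (Delta (monomial k (gen w true))).
Proof.
have Dw := valP w; have w0 := D_gt0 D0 Dw; set n := size (val w) in w0.
have -> : Delta (monomial k (gen w true)) =
    coef (boxed (sval (gseries_map i1 u)) (sval (gseries_map i2 u))) (val w).
  by rewrite coef_val; have := congr1 (fun f => sval f w) Delta_mul.
rewrite coef_boxed // (bigD1 (discrete n)) ?discrete_NC //.
set rest := (\sum_(pi in _ | _) _); exists rest.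
  rewrite /rest; elim/big_ind: _ => [||pi /andP[pN pd]]; [exact: Low0|exact: LowD|].
  rewrite !coef_part_map.
  have [a -> _] := coef_part_universal Dw pN.
  have [b -> degb] := coef_part_universal Dw (krew_NC pi).
  rewrite i1E i2E -monomialD -[monomial _ _]scale1r; apply: LowZ.
  rewrite add0r degb deg_genE /deg_gen /=; apply: sum_card_pred_lt (krew_NC pi) _ => //.
  by apply: contraNneq pd => /krew_eq_full->.
congr (_ + _); rewrite krew_discrete // coef_part_discrete coef_part_full.
under eq_bigr => i _ do rewrite coef_map.
have <- : i1 (\prod_(i <- val w) coef (sval u) [:: i]) =
    \prod_(i <- val w) i1 (coef (sval u) [:: i]) by rewrite rmorph_prod.
rewrite coef_letters_universal i1E coef_map (coef_universal Dw) i2E -monomialD.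
congr monomial; rewrite chi_genE /chi_gen /=; congr pair; first exact: addr0.
by rewrite [LHS]add0r; congr (gen _ _); apply: val_inj.
Qed.

Lemma Delta_triangular m : triangular m (Delta (monomial k m)).
Proof.
elim/mon_ind: m => [|[w b] m IHm]; first by rewrite monomial0 rmorph1; apply: triangular0.
rewrite monomialD rmorphM; apply: triangularM IHm; rewrite -/(gen w b).
case: b; first exact: Delta_gen_true.
have [w1|w1] := eqVneq (size (val w)) 1%N; last first.
  by rewrite gen_long // monomial0 rmorph1; apply: triangular0.
have degw : deg (gen w true) = 0%N by rewrite deg_genE /deg_gen /= w1.
have Dt := triangular_deg0 degw (Delta_gen_true w).
exists 0; first exact: Low0.
rewrite addr0 chi_genE /chi_gen /=.
(* The image of the inverse generator and the expected monomial are both inverse to the group-like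
   image of the letter, hence equal. *)
have e1 : Delta (monomial k (gen w true)) * Delta (monomial k (gen w false)) = 1.
  by rewrite -rmorphM -monomialD gen_inv // monomial0 rmorph1.
have e2 : Delta (monomial k (gen w true)) * monomial k (gen w false, gen w false) = 1.
  rewrite Dt -monomialD chi_genE chi_gen_letter // -monomial0; congr monomial.
  by congr pair; apply: gen_inv.
by rewrite -[LHS]mul1r -e2 mulrAC e1 mul1r.
Qed.

Lemma mcoef_Delta m m' m0 : (deg m <= deg m0)%N ->
  mcoef (Delta (monomial k m)) (m', m0) = ((m == m0) && (m' == chi m0))%:R.
Proof.
move=> le; have [y ly ->] := Delta_triangular m.
rewrite mcoefD (low_mcoef _ ly le) addr0 mcoef_monomial xpair_eqE andbC eq_sym.
by case: (eqVneq m0 m) => //= ->; rewrite eq_sym.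
Qed.

End Comultiplication.

(** Any point [a] is the image of the universal point under some [phi], so one eigenvector computed
    over the monoid algebra serves every coordinate ring. *)
Lemma gseries_eigenvector (A : comAlgType k) (a : gseries_group k s plus D A)
    (V : lmodType k) (X : representation (gseries_group k s plus D) V) :
  (exists v : V, v != 0) ->
  exists2 v : V, v != 0 &
  exists (phi : {lrmorphism B -> A}) (m : M),
    coaction a X v = tens v (phi (monomial k (chi m))).
Proof.
move=> V0; set G := gseries_group k s plus D in a X *.
have [GF _ _ _] := gseries_group_functor k s plus D0 D1 D_down.
have [||i1 i1E] := @monomial_lift k M B2 (fun m => monomial k (m, 0)) => //.
  by move=> x y; rewrite -monomialD; congr monomial; congr pair; rewrite addr0.
have [||i2 i2E] := @monomial_lift k M B2 (fun m => monomial k (0, m)) => //.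
  by move=> x y; rewrite -monomialD; congr monomial; congr pair; rewrite addr0.
(* Universality supplies the comultiplication: it classifies the product of the two copies of the
   universal point over k[M x M]. *)
have [[Delta Delta_mul] _] := coordinate_ring_universal
  (gmul G (gmap G i1 u) (gmap G i2 u)).
have u_inv : exists y : G B, gmul G y u = gone G B.
  by have [_ _ _ /(_ u)[y [yu _]]] := GF B; exists y.
have [v v0 [m E]] := eigenvector i1E i2E Delta_mul u_inv
  (mcoef_Delta i1E i2E Delta_mul) X V0.
exists v => //; have [[phi phiE] _] := coordinate_ring_universal a.
by exists phi, m; rewrite /coaction -phiE rep_act_gmap_tens E tens_map_tens.
Qed.

End Triangular.

(** * Unipotence and trigonalisability *)

Section Conclusion.
Variables (k : fieldType) (s : nat) (D : pred nat).
Hypothesis D0 : ~~ D 0%N.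
Hypothesis D1 : D 1%N.
Hypothesis D_down : forall l m, D m -> (0 < l <= m)%N -> D l.

Lemma gseries_plus_unipotent : unipotent (gseries_group k s true D).
Proof.
split; first exact: gseries_affine.
move=> A a _ V X /(gseries_eigenvector D0 D1 D_down a X)[v v0 [phi [m E]]].
by exists v => //; rewrite E chi_plus // monomial0 rmorph1.
Qed.

Lemma gseries_trigonalisable : trigonalisable (gseries_group k s false D).
Proof.
split; first exact: gseries_affine.
move=> A a _ V X /(gseries_eigenvector D0 D1 D_down a X)[v v0 [phi [m E]]].
by exists v => //; exists (phi (monomial k (chi D1 m))).
Qed.

End Conclusion.

Theorem proposition6p21 (k : fieldType) (s : nat) (hs : (1 <= s)%N) :
  ((forall n : nat, (1 <= n)%N ->
      algebraic_group (GG_plus_trunc k s n) /\ unipotent (GG_plus_trunc k s n)) /\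
   inverse_limit (S := tower k s true) (G := GG_plus k s) (@tower_proj k s true) /\
   pro_unipotent (GG_plus k s)) /\
  ((forall n : nat, (1 <= n)%N ->
      algebraic_group (GG_trunc k s n) /\ trigonalisable (GG_trunc k s n)) /\
   inverse_limit (S := tower k s false) (G := GG k s) (@tower_proj k s false) /\
   trigonalisable (GG k s)).
Proof.
have U n : (1 <= n)%N ->
    algebraic_group (GG_plus_trunc k s n) /\ unipotent (GG_plus_trunc k s n).
  move=> n1; split; first exact: gseries_upto_algebraic.
  apply: gseries_plus_unipotent => //; exact: lengths_upto_down.
split; split => //.
- split; first exact: tower_inverse_limit.
  split; first by apply: gseries_affine => //; apply: positive_lengths_down.
  exists (tower k s true), (@tower_proj k s true); split; last exact: tower_inverse_limit.
  by move=> i; apply: U.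
- move=> n n1; split; first exact: gseries_upto_algebraic.
  apply: gseries_trigonalisable => //; exact: lengths_upto_down.
- split; first exact: tower_inverse_limit.
  by apply: gseries_trigonalisable => //; apply: positive_lengths_down.
Qed.
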